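(* Let $n\ge 3$, set $y_1=\dots=y_n=0$, and let $w\in\operatorname{St}(n)$. Then the renormalized steady state probability $\psi_w$ is a polynomial in $x_1,\dots,x_n$, and the largest monomial $\eta(w)$ (with coefficient $1$) dividing $\psi_w$ is $$\eta(w)=\prod_{i=1}^{n-2}x_i^{\,a_i(w)+a_{i+1}(w)+\cdots+a_{n-2}(w)}.$$
   Context: Inhomogeneous TASEP with $y_i=0$: the state space $\operatorname{St}(n)$ consists of the $n!$ labelings of $n$ sites arranged in a ring by distinct numbers $1,\dots,n$, identified with permutations $w=(w_1,\dots,w_n)\in S_n$ (read around the ring, with $w_n$ adjacent to $w_1$). It is a continuous-time Markov chain in which two adjacent particles, $i$ on the left and $j$ on the right (including the pair $w_n,w_1$), swap with rate $x_i$ if $i<j$ and rate $0$ otherwise. The renormalized steady state probabilities $\psi_w$ are the stationary probabilities all multiplied by the common constant chosen so that $\psi_{12\cdots n}=\prod_{1\le i<j\le n}x_i^{j-i-1}$. For $1\le i\le n-2$, $a_i(w)$ is the number of letters greater than $i+1$ among the letters strictly between $i+1$ and $i$ when $w$ is read cyclically to the right (clockwise around the ring) starting at $i+1$ and stopping at $i$. (E.g. for $w=12345$: $a_1=3,a_2=2,a_3=1$.) *)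

(* Defs.v *)
From mathcomp Require Import all_boot all_order all_algebra all_fingroup.
From mathcomp Require Import fraction mpoly.
Import GRing.Theory.
Set Implicit Arguments. Unset Strict Implicit. Unset Printing Implicit Defensive.
Local Open Scope ring_scope.

(* Conventions (0-based): sites = positions 'I_n around the ring (position
   ordS p is the right neighbour of p, position n-1 is adjacent to 0);
   particle labels 1..n of the paper are 0..n-1 (ordinals 'I_n);
   the variable x_{i+1} of the paper is 'X_i.  A state w : 'S_n puts
   particle w p at site p. *)

Definition PolyT (n : nat) := {mpoly int[n]}.
Definition FracT (n : nat) := {fraction (PolyT n)}.
Notation "x %:F" := (@FracField.tofrac _ x) : ring_scope.

Definition swap_at n (p : 'I_n) : 'S_n := tperm p (ordS p).

Definition rate n (w : 'S_n) (p : 'I_n) : PolyT n :=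
  if (w p < w (ordS p))%N then 'X_(w p) else 0.

Definition out_rate n (w : 'S_n) : PolyT n := \sum_(p < n) rate w p.

(* Global balance equations of the continuous-time Markov chain:
   (swap_at p * w) is the state v with v x = w (swap_at p x), i.e. the state
   which becomes w by swapping its sites p and p+1. *)
Definition is_stationary n (psi : 'S_n -> FracT n) : Prop :=
  forall w : 'S_n,
    psi w * (out_rate w)%:F =
    \sum_(p < n) psi ((swap_at p * w)%g) * (rate ((swap_at p * w)%g) p)%:F.

Definition psi_id_value n : PolyT n :=
  \prod_(i < n) \prod_(j < n | (i < j)%N) 'X_i ^+ (j - i - 1).

Definition is_normalized n (psi : 'S_n -> FracT n) : Prop :=
  psi 1%g = (psi_id_value n)%:F.

Definition cdist n (q p : 'I_n) : nat := ((p + n - q) %% n)%N.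

(* a_stat w i  (i = 0..n-3)  is the paper's a_{i+1}(w): the number of
   particles with (0-based) label > i+1 found strictly between the particle
   labelled i+1 and the particle labelled i, reading clockwise (to the right)
   from the former to the latter. *)
Definition a_stat n (w : 'S_n) (i : nat) : nat :=
  #|[set p : 'I_n | (i.+1 < w p)%N &&
      [exists q1 : 'I_n, exists q0 : 'I_n,
        [&& (w q1 == i.+1 :> nat), (w q0 == i :> nat),
            (0 < cdist q1 p)%N & (cdist q1 p < cdist q1 q0)%N]]]|.

(* eta(w) = prod_{i=1}^{n-2} x_i^(a_i + ... + a_{n-2}); as a monomial
   exponent vector (0-based: exponent of 'X_j is sum_{j<=k<n-2} a_stat w k,
   which is 0 for j >= n-2). *)
Definition eta_mnm n (w : 'S_n) : 'X_{1..n} :=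
  [multinom (\sum_(j <= k < n - 2) a_stat w k)%N | j < n].

Definition mdvd n (m : 'X_{1..n}) (p : PolyT n) : Prop :=
  exists q : PolyT n, p = 'X_[m] * q.

Definition largest_monomial_divisor n (p : PolyT n) (m : 'X_{1..n}) : Prop :=
  mdvd m p /\ forall m' : 'X_{1..n}, mdvd m' p -> mdvd m' 'X_[m].

(* Main.v *)
Require Import Defs.
From mathcomp Require Import all_boot all_order all_algebra all_fingroup.
From mathcomp Require Import fraction mpoly zify ring.
Import GRing.Theory.
Set Implicit Arguments. Unset Strict Implicit. Unset Printing Implicit Defensive.

(** A stationary vector with nonnegative integer coefficients is built from
    multiline queues: layer [m] sends a word with classes [0..m] to a word with
    classes [0..m+1] through a priority queue that travels around the ring
    against the particles. A "hat" relation for two adjacent sites telescopes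
    around the ring and carries stationarity from one layer to the next. The
    identity comes from a single multiline queue, whose weight is the required
    normalization, and the stationary vector is unique up to scaling because it
    already is when all rates are [1].

    The exponents need no queues. Put [x_i = t] and all other variables equal
    to [1], let [val] be the order at [t = 0], and let
    [W(w) = a_i(w) + ... + a_{n-2}(w)]. Exchanging adjacent letters [a < b] of
    [u] into [w] gives [W(w) = W(u) + [a = i]] when [b > a + 1] or [a < i] (a
    "tight" swap), and [W(w) < W(u) + [a = i]] otherwise. Hence the leading
    coefficients of [psi] at the order [W(w) + min (val psi - W)] satisfy a
    balance equation in which only tight swaps feed a state. Their support is
    closed under tight swaps; by conservation of mass on its minimal layer it
    contains the decreasing word, from which tight swaps reach every state. So
    [val psi_w - W(w)] is constant, and the normalization makes it [0]. *)

(** * Swaps on the ring and the statistics a_k *)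

Lemma val_ordS n (p : 'I_n) : (ordS p : nat) = if p.+1 == n then 0 else p.+1.
Proof.
rewrite /=; case: eqVneq => [->|H]; first by rewrite modnn.
by rewrite modn_small //; move: (ltn_ord p) H; lia.
Qed.

Lemma cdistE n (q p : 'I_n) :
  cdist q p = if q <= p then p - q else p + n - q.
Proof.
rewrite /cdist; have := ltn_ord q; have := ltn_ord p.
move=> hp hq; case: leqP => h; last by rewrite modn_small //; lia.
have -> : p + n - q = p - q + n by lia.
by rewrite modnDr modn_small //; lia.
Qed.

Lemma ordS_neq n (p : 'I_n) : 1 < n -> ordS p != p.
Proof.
move=> hn; apply/eqP => e; have := val_ordS p; rewrite e.
move: (ltn_ord p) hn; case: (p.+1 =P n) => h; lia.
Qed.

Lemma swap_atE n (p x : 'I_n) :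
  swap_at p x = if x == p then ordS p else if x == ordS p then p else x.
Proof. by rewrite /swap_at permE /=. Qed.

Lemma swap_at_l n (p : 'I_n) : swap_at p p = ordS p.
Proof. exact: tpermL. Qed.

Lemma swap_at_r n (p : 'I_n) : swap_at p (ordS p) = p.
Proof. exact: tpermR. Qed.

Lemma swap_atK n (p : 'I_n) : involutive (swap_at p).
Proof. exact: tpermK. Qed.

Lemma swap_at_mulK n (p : 'I_n) (w : 'S_n) : (swap_at p * (swap_at p * w))%g = w.
Proof. by rewrite mulgA /swap_at tperm2 mul1g. Qed.

Definition ascent n (w : 'S_n) (p : 'I_n) : bool := w p < w (ordS p).

Lemma ascent_swap n (w : 'S_n) (p : 'I_n) :
  ascent (swap_at p * w)%g p = (w (ordS p) < w p).
Proof. by rewrite /ascent !permM swap_at_l swap_at_r. Qed.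

(** Clockwise order of three distinct sites without the modulus of [cdist], so that linear
    arithmetic decides it. *)
Definition cyclic_lt (a b c : nat) := [|| a < b < c, b < c < a | c < a < b].

Lemma cdist_cyclic n (q y r : 'I_n) : q != y -> r != y -> q != r ->
  (0 < cdist q y < cdist q r) = cyclic_lt q y r.
Proof.
rewrite /cyclic_lt !cdistE -!val_eqE /=.
move: (ltn_ord q) (ltn_ord y) (ltn_ord r).
by case: (leqP q y) => h1; case: (leqP q r) => h2; lia.
Qed.

(* Both conditions say that [q], [y], [r] are in cyclic order; exchanging two of
   the three sites reverses the orientation. *)
Lemma between_swap n (p q y r : 'I_n) : 2 < n ->
  q != y -> r != y -> q != r ->
  (0 < cdist (swap_at p q) (swap_at p y) < cdist (swap_at p q) (swap_at p r)) =
  (0 < cdist q y < cdist q r) (+)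
  ((p \in [:: q; y; r]) && (ordS p \in [:: q; y; r])).
Proof.
move=> hn hqy hry hqr.
rewrite !cdist_cyclic ?(inj_eq perm_inj) // !inE !swap_atE.
move: (val_ordS p) hqy hry hqr; move: (ordS p) => s; rewrite -!val_eqE /=.
case: p q y r s => [p ?] [a ?] [b ?] [c ?] [s ?] /= hs.
have {hs} : s = p.+1 /\ p.+1 < n \/ s = 0 /\ p.+1 = n.
  by case: eqP hs; lia.
rewrite !(fun_if (@nat_of_ord n)) /cyclic_lt /= => hs h1 h2 h3.
case: hs => -[? hs]; subst s; last (have {hs} ? : n = p.+1 by lia); try subst n.
all: case: (eqVneq a p) => [?|?]; [|case: (eqVneq a _) => [?|?]];
(case: (eqVneq b p) => [?|?]; [|case: (eqVneq b _) => [?|?]]);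
(case: (eqVneq c p) => [?|?]; [|case: (eqVneq c _) => [?|?]]);
try subst a; try subst b; try subst c; rewrite ?eqxx in h1 h2 h3 => //.
all: rewrite ?eqxx /= ?orbT ?orbF ?andbT ?addbT ?addbF.
all: lia.
Qed.

Lemma letter_at n (w : 'S_n) k : k < n -> exists p : 'I_n, w p = k :> nat.
Proof.
move=> hk; exists ((w^-1)%g (Ordinal hk)).
by rewrite permKV.
Qed.

Lemma perm_val_eq n (w : 'S_n) (p q : 'I_n) : (w p == w q :> nat) = (p == q).
Proof. by rewrite (inj_eq val_inj) (inj_eq perm_inj). Qed.

Lemma a_statE n (w : 'S_n) (q r : 'I_n) k :
  w q = k.+1 :> nat -> w r = k :> nat ->
  a_stat w k = #|[set y : 'I_n | (k.+1 < w y) && (0 < cdist q y < cdist q r)]|.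
Proof.
move=> hq hr; apply: eq_card => y; rewrite !inE; congr andb.
apply/existsP/idP => [[q1 /existsP [q0 /and4P[/eqP h1 /eqP h0 ha hb]]]|/andP[ha hb]].
  have -> : q = q1 by apply/eqP; rewrite -(perm_val_eq w) h1 hq.
  by have -> : r = q0 by [apply/eqP; rewrite -(perm_val_eq w) h0 hr]; rewrite ha.
by exists q; apply/existsP; exists r; rewrite hq hr !eqxx ha.
Qed.

(** The set is pulled back along [swap_at p]: the counts before and after the swap then range over
    the same letters, indexed by their old sites. *)
Lemma a_stat_swapE n (w : 'S_n) (p q r : 'I_n) k :
  w q = k.+1 :> nat -> w r = k :> nat ->
  a_stat (swap_at p * w)%g k =
  #|[set y : 'I_n | (k.+1 < w y) &&
      (0 < cdist (swap_at p q) (swap_at p y) < cdist (swap_at p q) (swap_at p r))]|.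
Proof.
move=> hq hr.
rewrite (@a_statE _ _ (swap_at p q) (swap_at p r)); last 2 first.
- by rewrite permM swap_atK.
- by rewrite permM swap_atK.
rewrite -(card_preimset _ (@perm_inj _ (swap_at p))); apply: eq_card => y.
by rewrite !inE permM swap_atK.
Qed.

Section AStatSwap.
Variables (n : nat) (hn : 2 < n) (u : 'S_n) (p : 'I_n).
Hypothesis asc : ascent u p.

Let p_neq : ordS p != p. Proof. by apply: ordS_neq; lia. Qed.

(** The cyclic order of the sites of [k.+1], [k] and a counted letter changes only if both swapped
    sites are among the three. The hypotheses force [u p] to be the counted letter, and then the
    larger swapped letter exceeds [k.+1] too. *)
Lemma a_stat_swap_eq k : k.+1 < n -> k != u p -> k.+1 != u p ->
  a_stat (swap_at p * u)%g k = a_stat u k.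
Proof.
move=> hk h1 h2.
have [q hq] := letter_at u hk; have [r hr] := letter_at u (ltnW hk).
rewrite (a_stat_swapE _ hq hr) (a_statE hq hr); apply: eq_card => y; rewrite !inE.
case hy : (_ < u y) => //=.
have nqy : q != y by rewrite -(perm_val_eq u) hq; lia.
have nry : r != y by rewrite -(perm_val_eq u) hr; lia.
have nqr : q != r by rewrite -(perm_val_eq u) hq hr; lia.
rewrite between_swap // !inE.
have -> : p == q = false by rewrite -(perm_val_eq u) hq; lia.
have -> : p == r = false by rewrite -(perm_val_eq u) hr; lia.
rewrite orbF /=; case: (p =P y) => [py|_]; last by rewrite addbF.
subst y; rewrite /= (negPf p_neq) /=; move: asc; rewrite /ascent => hasc.
have -> : ordS p == q = false by rewrite -(perm_val_eq u) hq; lia.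
have -> : ordS p == r = false by rewrite -(perm_val_eq u) hr; lia.
by rewrite addbF.
Qed.

(** After the swap [(u p).+1] stands immediately to the left of [u p], so no letter lies between. *)
Lemma a_stat_swap_top : u (ordS p) = (u p).+1 :> nat ->
  a_stat (swap_at p * u)%g (u p) = 0.
Proof.
move=> hb; rewrite (a_stat_swapE _ hb erefl).
apply: eq_card0 => y; rewrite !inE swap_at_l swap_at_r.
have -> : cdist p (ordS p) = 1.
  rewrite cdistE; move: (val_ordS p) (ltn_ord p) hn.
  by case: (p.+1 =P n) => h; case: ifP; lia.
by case: (cdist _ _) => [|?]; rewrite ?andbF.
Qed.

(** The larger letter stood just to the right of [u p], outside the arc ending there; the swap makes
    it the last letter of the arc. *)
Lemma a_stat_swap_self : (u p).+1 < u (ordS p) ->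
  a_stat (swap_at p * u)%g (u p) = (a_stat u (u p)).+1.
Proof.
move=> hb; have hk : (u p).+1 < n by move: (ltn_ord (u (ordS p))); lia.
have [q hq] := letter_at u hk.
rewrite (a_stat_swapE _ hq erefl) (a_statE hq erefl).
have nqp : q != p by rewrite -(perm_val_eq u) hq; lia.
have nqs : q != ordS p by rewrite -(perm_val_eq u) hq; lia.
rewrite (cardsD1 (ordS p)) !inE hb /= between_swap //; last by rewrite eq_sym.
rewrite !inE !eqxx !orbT /= addbT.
have -> : (0 < cdist q (ordS p) < cdist q p) = false.
  rewrite cdist_cyclic // 1?eq_sym // /cyclic_lt.
  move: (val_ordS p) nqp nqs; rewrite -!val_eqE /=.
  move: (ltn_ord p) (ltn_ord q).
  by case: (p.+1 =P n) => h h1 h2 /= ->; lia.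
rewrite /= add1n; congr S.
apply: eq_card => y; rewrite !inE.
case: (y =P ordS p) => [->|/eqP ys] /=.
  apply/esym/negbTE; rewrite negb_and; apply/orP; right.
  rewrite cdist_cyclic // 1?eq_sym // /cyclic_lt.
  move: (val_ordS p) nqp nqs; rewrite -!val_eqE /=.
  move: (ltn_ord p) (ltn_ord q).
  by case: (p.+1 =P n) => h h1 h2 /= ->; lia.
case hy : (_ < u y) => //=.
have nqy : q != y by rewrite -(perm_val_eq u) hq; lia.
have nry : p != y by rewrite -(perm_val_eq u); lia.
rewrite between_swap // !inE.
by rewrite [ordS p == q]eq_sym (negPf nqs) [ordS p == y]eq_sym (negPf ys) (negPf p_neq) !andbF addbF.
Qed.

(** The larger letter was the first one read after [k.+1]; the swap moves it to the left, out of the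
    arc. *)
Lemma a_stat_swap_pred k : k.+1 = u p ->
  a_stat u k = (a_stat (swap_at p * u)%g k).+1.
Proof.
move=> hq; have hk : k < n by move: (ltn_ord (u p)); lia.
have hab : k.+1 < u (ordS p) by rewrite hq.
have [r hr] := letter_at u hk.
rewrite (a_stat_swapE _ (esym hq) hr) (a_statE (esym hq) hr).
have nrp : r != p by rewrite -(perm_val_eq u) hr; lia.
have nrs : r != ordS p by rewrite -(perm_val_eq u) hr; lia.
have F : 0 < cdist p (ordS p) < cdist p r.
  rewrite cdist_cyclic // 1?eq_sym // /cyclic_lt.
  move: (val_ordS p) nrp nrs; rewrite -!val_eqE /=.
  move: (ltn_ord p) (ltn_ord r).
  by case: (p.+1 =P n) => h h1 h2 /= ->; lia.
rewrite (cardsD1 (ordS p)) !inE hab F add1n; congr S.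
apply: eq_card => y; rewrite !inE.
case: (y =P ordS p) => [->|/eqP ys] /=.
  rewrite between_swap // 1?eq_sym // 1?eq_sym // F !inE !eqxx !orbT.
  by rewrite andbF.
case hy : (_ < u y) => //=.
have nqy : p != y by rewrite -(perm_val_eq u) -hq; lia.
have nry : r != y by rewrite -(perm_val_eq u) hr; lia.
rewrite between_swap // 1?eq_sym // !inE.
by rewrite [ordS p == r]eq_sym (negPf nrs) [ordS p == y]eq_sym (negPf ys) (negPf p_neq) !andbF addbF.
Qed.

End AStatSwap.

Definition eta_exp n (w : 'S_n) (i : nat) : nat := \sum_(i <= k < n - 2) a_stat w k.

Lemma sum_nat_eq a i N : \sum_(i <= k < N) (k == a : nat) = (i <= a < N).
Proof.
rewrite -(mem_index_iota i N a) -count_uniq_mem ?iota_uniq // -sum1_count.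
by rewrite [RHS]big_mkcond; apply: eq_bigr => k _ /=; case: eqP.
Qed.

Lemma sum_nat_succ_eq a i N : \sum_(i <= k < N) (k.+1 == a : nat) = (i < a <= N).
Proof.
case: a => [|a]; first by rewrite big1.
by under eq_bigr do rewrite eqSS; rewrite sum_nat_eq ltnS.
Qed.

(* The swaps along which [eta_exp _ i] grows exactly as the exponent of the rate
   in ['X_i]. *)
Definition tight_swap n (i : nat) (u : 'S_n) (p : 'I_n) : bool :=
  ascent u p && (((u p).+1 < u (ordS p)) || (u p < i)).

Section EtaSwap.
Variables (n : nat) (hn : 2 < n) (u : 'S_n) (p : 'I_n).
Local Notation w := (swap_at p * u)%g.

(** Two summands change: the one at [u p] grows by one, the one at its predecessor drops by one. The
    two corrections record which of these indices are in range; the gap keeps [u p] below the upper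
    limit. *)
Lemma eta_exp_swap_gap i : (u p).+1 < u (ordS p) -> 
  eta_exp w i + (i < u p) = eta_exp u i + (i <= u p).
Proof.
move=> hb; have asc : ascent u p by rewrite /ascent; lia.
have hn2 : u p < n - 2 by move: (ltn_ord (u (ordS p))); lia.
have -> : (i < u p) = (i < u p <= n - 2) by lia.
have -> : (i <= u p) = (i <= u p < n - 2) by lia.
rewrite -sum_nat_eq -sum_nat_succ_eq -!big_split /=.
rewrite big_nat_cond [RHS]big_nat_cond; apply: eq_bigr => k /andP[/andP[_ hk] _].
have [e|ne] := eqVneq k (u p).
  by rewrite e a_stat_swap_self //; lia.
have [e|ne'] := eqVneq k.+1 (u p); last by rewrite a_stat_swap_eq //; lia.
by rewrite (a_stat_swap_pred hn asc e); lia.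
Qed.

Lemma eta_exp_swap_low i : ascent u p -> u p < i -> eta_exp w i = eta_exp u i.
Proof.
move=> asc hi; rewrite /eta_exp big_nat_cond [RHS]big_nat_cond.
by apply: eq_bigr => k /andP[/andP[hik hk] _]; rewrite a_stat_swap_eq //; lia.
Qed.

Lemma eta_exp_swap_tight i : tight_swap i u p ->
  eta_exp w i = eta_exp u i + (u p == i :> nat).
Proof.
case/andP=> asc; have [lt _|le] := ltnP (u p) i.
  by rewrite eta_exp_swap_low //; lia.
by rewrite orbF => hb; move: (eta_exp_swap_gap i hb); lia.
Qed.

(** The letters are consecutive and the smaller is at least [i]. The summand at [u p] falls to zero
    and the one at its predecessor, if in range, drops by one; it is out of range only when
    [u p = i], where the right-hand side gains one. *)
Lemma eta_exp_swap_loose i : ascent u p -> ~~ tight_swap i u p ->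
  eta_exp w i < eta_exp u i + (u p == i :> nat).
Proof.
move=> asc; rewrite /tight_swap asc negb_or => /andP[hb hi].
have eb : u (ordS p) = (u p).+1 :> nat by move: asc; rewrite /ascent; lia.
suff H : eta_exp w i + (i < u p <= n - 2) <= eta_exp u i.
  have := ltn_ord (u (ordS p)); lia.
rewrite -sum_nat_succ_eq -big_split /=.
rewrite big_nat_cond [X in _ <= X]big_nat_cond; apply: leq_sum => k /andP[/andP[_ hk] _].
have [e|ne] := eqVneq k (u p).
  by rewrite e a_stat_swap_top //; lia.
have [e|ne'] := eqVneq k.+1 (u p); last by rewrite a_stat_swap_eq //; lia.
by rewrite (a_stat_swap_pred hn asc e); lia.
Qed.

End EtaSwap.

(* Potential function for chains of tight swaps. *)
Definition eta_total n (w : 'S_n) (i : nat) : nat :=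
  \sum_(i <= j < n - 2) eta_exp w j.

Lemma eta_total_swap_low n (u : 'S_n) p i : 2 < n -> ascent u p -> u p < i ->
  eta_total (swap_at p * u)%g i = eta_total u i.
Proof.
move=> hn asc hi; rewrite /eta_total big_nat_cond [RHS]big_nat_cond.
by apply: eq_bigr => j /andP[/andP[hj _] _]; rewrite eta_exp_swap_low //; lia.
Qed.

(** The term [eta_exp _ j] grows by one for [j = u p] and is constant for all other [j]. *)
Lemma eta_total_swap_gap n (u : 'S_n) p i : 2 < n ->
  (u p).+1 < u (ordS p) -> i <= u p ->
  eta_total (swap_at p * u)%g i = (eta_total u i).+1.
Proof.
move=> hn hb hi; have hn2 : u p < n - 2 by move: (ltn_ord (u (ordS p))); lia.
have := sum_nat_eq (u p) i (n - 2); rewrite hi hn2 /= => e.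
rewrite -addn1 -e -big_split /=.
apply: eq_bigr => j _; have := eta_exp_swap_gap hn j hb; lia.
Qed.

(** * Rotations of the ring *)

Definition rotation n : 'S_n := perm (can_inj (@ordSK n)).

Lemma rotationE n (x : 'I_n) : rotation n x = ordS x.
Proof. by rewrite permE. Qed.

Lemma swap_at_rotation n (p : 'I_n) :
  (swap_at p * rotation n = rotation n * swap_at (ordS p))%g.
Proof.
by rewrite /swap_at -!rotationE -tpermJ conjgE !mulgA mulgV mul1g.
Qed.

Lemma ascent_rotation n (w : 'S_n) p : ascent (rotation n * w)%g p = ascent w (ordS p).
Proof. by rewrite /ascent !permM !rotationE. Qed.

Lemma rotation_expE n k (x : 'I_n) : (rotation n ^+ k)%g x = (x + k) %% n :> nat.
Proof.
elim: k => [|k IH]; first by rewrite perm1 addn0 modn_small.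
by rewrite expgSr permM rotationE /= IH -addn1 modnDml addn1 addnS.
Qed.

Lemma rotate_to n (w : 'S_n) (q r : 'I_n) :
  exists k, (rotation n ^+ k * w)%g r = w q.
Proof.
exists (q + n - r); rewrite permM; congr (w _); apply: val_inj => /=.
rewrite rotation_expE; have -> : r + (q + n - r) = q + n by move: (ltn_ord r); lia.
by rewrite modnDr modn_small.
Qed.

Section RotationInvariant.
Variables (n : nat) (P : 'S_n -> Prop).
Hypothesis rotP : forall w, P (rotation n * w)%g -> P w.

Lemma rotation_exp_closed k w : P (rotation n ^+ k * w)%g -> P w.
Proof.
elim: k => [|k IH]; first by rewrite mul1g.
by rewrite expgS -mulgA => /rotP.
Qed.

(** The rotation has finite order, so undoing it often enough amounts to performing it. *)
Lemma rotation_exp_closed_inv k w : P w -> P (rotation n ^+ k * w)%g.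
Proof.
move=> Pw; have E : (rotation n ^+ (#[rotation n]%g * k - k) * (rotation n ^+ k * w) = w)%g.
  have hk : k <= #[rotation n]%g * k by rewrite leq_pmull // order_gt0.
  by rewrite mulgA -expgD subnK // expgM expg_order expg1n mul1g.
by apply: (@rotation_exp_closed (#[rotation n]%g * k - k)); rewrite E.
Qed.

End RotationInvariant.

Lemma a_stat_rotation n (w : 'S_n) k : k.+1 < n ->
  a_stat (rotation n * w)%g k = a_stat w k.
Proof.
move=> hk; have [q hq] := letter_at w hk; have [r hr] := letter_at w (ltnW hk).
rewrite (a_statE hq hr) (@a_statE _ _ (ord_pred q) (ord_pred r)); last 2 first.
- by rewrite permM rotationE ord_predK.
- by rewrite permM rotationE ord_predK.
rewrite -[RHS](card_preimset _ (@perm_inj _ (rotation n))); apply: eq_card => y.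
have C (a b : 'I_n) : cdist (ordS a) (ordS b) = cdist a b.
  rewrite !cdistE; move: (val_ordS a) (val_ordS b) (ltn_ord a) (ltn_ord b).
  by case: (a.+1 =P n) => h1; case: (b.+1 =P n) => h2 /= -> -> ? ?; case: leqP => ?; case: leqP => ?; lia.
have C' (a b : 'I_n) : cdist (ord_pred a) b = cdist a (ordS b).
  by rewrite -(C (ord_pred a)) ord_predK.
by rewrite !inE permM !rotationE !C' ord_predK.
Qed.

Lemma eta_exp_rotation n (w : 'S_n) i : eta_exp (rotation n * w)%g i = eta_exp w i.
Proof.
rewrite /eta_exp big_nat_cond [RHS]big_nat_cond.
by apply: eq_bigr => k /andP[/andP[_ hk] _]; rewrite a_stat_rotation //; lia.
Qed.

(** * Extremal words and reachability *)

Definition descending n : 'S_n := perm (@rev_ord_inj n).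

Lemma descendingE n (x : 'I_n) : descending n x = n - x.+1 :> nat.
Proof. by rewrite permE. Qed.

Lemma val_ordS_lt n (p : 'I_n) : p.+1 < n -> ordS p = p.+1 :> nat.
Proof. by move=> h; rewrite val_ordS ltn_eqF. Qed.

Lemma perm_neq_ordS n (w : 'S_n) (p : 'I_n) : 1 < n -> w (ordS p) != w p :> nat.
Proof. by move=> hn; rewrite perm_val_eq ordS_neq. Qed.

(** Letters drop by at least one per site, so letter plus site is nonincreasing. *)
Lemma perm_chain n (w : 'S_n) N (x y : 'I_n) :
  (forall p : 'I_n, p.+1 < N -> w (ordS p) < w p) ->
  N <= n -> x <= y -> y < N -> w y + y <= w x + x.
Proof.
move=> H hN; case: y => y hy /= hxy; elim: y hy hxy => [|y IH] hy hxy hyN.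
  by have -> : x = Ordinal hy by apply: val_inj => /=; lia.
have [e|ne] := eqVneq (x : nat) y.+1.
  by have -> : x = Ordinal hy by apply: val_inj.
have hy' : y < n by lia.
have e : ordS (Ordinal hy') = Ordinal hy by apply: val_inj; rewrite /= modn_small.
have := H (Ordinal hy') hyN; rewrite e.
by have := IH hy' ltac:(lia) ltac:(lia); lia.
Qed.

Lemma not_ascent n (w : 'S_n) p : 1 < n -> ~~ ascent w p -> w (ordS p) < w p.
Proof. by move=> hn; rewrite /ascent -leqNgt; have := perm_neq_ordS w p hn; lia. Qed.

Lemma descendingP n (w : 'S_n) : 1 < n ->
  (forall p : 'I_n, p.+1 < n -> ~~ ascent w p) -> w = descending n.
Proof.
move=> hn H; apply/permP => x; apply: val_inj; rewrite /= descendingE.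
have H' (p : 'I_n) : p.+1 < n -> w (ordS p) < w p by move=> /H; apply: not_ascent.
have h0 : 0 < n by lia. have hl : n.-1 < n by lia.
have := perm_chain (x := Ordinal h0) (y := x) H' (leqnn n) isT (ltn_ord x).
have := perm_chain (x := x) (y := Ordinal hl) H' (leqnn n).
rewrite /= => /(_ ltac:(move: (ltn_ord x); lia) ltac:(lia)).
move: (ltn_ord x) (ltn_ord (w (Ordinal h0))); lia.
Qed.

Section Cyclic.
Variables (n : nat) (hn : 2 < n).
Let h0 : 0 < n. Proof. by lia. Qed.
Let hl : n.-1 < n. Proof. by lia. Qed.

(** Rotate the largest letter to site [0]. Each next letter is then smaller than its left neighbour,
    since the larger ones are used up, and hence smaller by exactly one. *)
Lemma rotate_descending (w : 'S_n) :
  (forall p, w (ordS p) < w p -> w p = (w (ordS p)).+1 :> nat) ->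
  exists k, (rotation n ^+ k * w)%g = descending n.
Proof.
move=> H; have [q hq] := letter_at w hl.
have [k hk] := rotate_to w q (Ordinal h0); exists k.
pose P (v : 'S_n) := forall p, v (ordS p) < v p -> v p = (v (ordS p)).+1 :> nat.
have {H} : P (rotation n ^+ k * w)%g.
  apply: rotation_exp_closed_inv H => v Hv p hp.
  have := Hv (ord_pred p); rewrite !permM !rotationE !ord_predK; exact.
move: hk; rewrite -[w q]/(w q); set v := (_ * w)%g => hv H.
apply/permP => x; apply: val_inj; rewrite /= descendingE.
case: x => x hx; elim/ltn_ind: x hx => -[|x] IH hx.
  have -> : Ordinal hx = Ordinal h0 by apply: val_inj.
  by rewrite hv hq /=; lia.
have hx' : x < n by lia.
have e : ordS (Ordinal hx') = Ordinal hx by apply: val_inj; rewrite /= modn_small.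
have := H (Ordinal hx'); rewrite e (IH x (leqnn _)) /=.
suff : v (Ordinal hx) < n - x.+1 by move=> h /(_ h); lia.
(* A letter this large already sits at an earlier site. *)
rewrite ltnNge; apply/negP => hle.
have hy : n - (v (Ordinal hx)).+1 < n by lia.
have := IH (n - (v (Ordinal hx)).+1) ltac:(lia) hy.
have -> : n - (Ordinal hy).+1 = v (Ordinal hx) by move: (ltn_ord (v (Ordinal hx))) => /=; lia.
move/eqP; rewrite perm_val_eq => /eqP/(congr1 (@nat_of_ord n)) /=.
move: (ltn_ord (v (Ordinal hx))); lia.
Qed.

(** A descent by at least two is the trace of a swap that is tight for every [i], so only rotations
    of the decreasing word can lack such a predecessor. *)
Lemma descending_or_gap (w : 'S_n) :
  (exists k, (rotation n ^+ k * w)%g = descending n) \/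
  (exists2 p, (w (ordS p)).+1 < w p & True).
Proof.
case: (pickP (fun p => (w (ordS p)).+1 < w p)) => [p hp|H]; first by right; exists p.
left; apply: rotate_descending => p hp; have := H p; lia.
Qed.

(* Decreasing word with letter [i] moved to site [k]. *)
Definition displaced i k (w : 'S_n) := forall x : 'I_n, w x = (if x == k :> nat then i
  else let y := x - (k < x) in if y < n.-1 - i then n.-1 - y else n - 2 - y) :> nat.

Lemma displaced_descending i (w : 'S_n) : i < n ->
  displaced i (n.-1 - i) w -> w = descending n.
Proof.
move=> hi H; apply/permP => x; apply: val_inj; rewrite /= descendingE H /=.
move: (ltn_ord x).
case: eqP => // h; first by lia.
case: ltnP => h1 /=; case: ltnP => h2; lia.
Qed.

(** The letter at site [k] is [n - 2 - k], which is below [i]; exchanging it with [i] is therefore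
    tight. *)
Lemma displaced_step i k (w : 'S_n) : n.-1 - i <= k -> k.+1 < n -> i < n ->
  displaced i k.+1 w ->
  exists2 p, tight_swap i w p & displaced i k (swap_at p * w)%g.
Proof.
move=> h1 h2 hi H; have hk : k < n by lia.
exists (Ordinal hk).
  rewrite /tight_swap /ascent !H val_ordS_lt //= eqxx.
  have -> : (k == k.+1) = false by lia.
  have -> : (k.+1 < k) = false by lia.
  have -> : (k - false < n.-1 - i) = false by lia.
  by rewrite subn0; lia.
move=> x; rewrite permM swap_atE; case: eqP => [->|/eqP nx].
  by rewrite H val_ordS_lt //= !eqxx.
case: eqP => [->|/eqP nxs].
  rewrite H val_ordS_lt //= ltnSn subn1 /=.
  have -> : (k == k.+1) = false by lia.
  have -> : (k.+1 == k) = false by lia.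
  have -> : (k.+1 < k) = false by lia.
  by rewrite subn0.
have nx' : x != k :> nat by apply: contraNneq nx => e; apply/eqP/val_inj.
have nxs' : x != k.+1 :> nat.
  by apply: contraNneq nxs => e; apply/eqP/ord_inj; rewrite val_ordS_lt.
rewrite H (negPf nx') (negPf nxs').
by have -> : (k.+1 < x) = (k < x) by lia.
Qed.

Lemma rotate_displaced i (w : 'S_n) : i < n ->
  (forall p, ascent w p -> w p = i :> nat \/ w (ordS p) = i :> nat) ->
  exists k, displaced i n.-1 (rotation n ^+ k * w)%g.
Proof.
move=> hi H; have [q hq] := letter_at w hi.
have [k hk] := rotate_to w q (Ordinal hl); exists k.
pose P (v : 'S_n) := forall p, ascent v p -> v p = i :> nat \/ v (ordS p) = i :> nat.
have {H} : P (rotation n ^+ k * w)%g.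
  apply: rotation_exp_closed_inv H => v Hv p hp.
  have := Hv (ord_pred p); rewrite ascent_rotation !permM !rotationE !ord_predK; exact.
move: hk; set v := (_ * w)%g => hv H.
have vi x : (v x == i :> nat) = (x == n.-1 :> nat).
  by rewrite -hq -hv perm_val_eq -val_eqE.
have {H} D (p : 'I_n) : p.+1 < n.-1 -> v (ordS p) < v p.
  move=> hp; apply: not_ascent; first lia.
  apply/negP => /H []/eqP; rewrite vi; last rewrite val_ordS_lt; lia.
have C := perm_chain D (leq_pred n).
move=> x; case: eqP => [/eqP|/eqP hx]; first by rewrite -vi => /eqP.
have hxn : x < n.-1 by move: (ltn_ord x); lia.
have -> : (n.-1 < x) = false by lia.
have hll : n - 2 < n by lia.
have U := C (Ordinal h0) x isT hxn.
have L := C x (Ordinal hll) ltac:(move => /=; lia) ltac:(move => /=; lia).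
move: (ltn_ord (v (Ordinal h0))) U L => /= U0 U L; rewrite subn0.
have V (y : 'I_n) : y != n.-1 :> nat -> v y != i :> nat by move=> h; rewrite vi.
(* The chain bounds leave only [n - 2] and [n.-1] for the nonincreasing quantity [v x + x]; the
   missing letter [i] determines where it drops. *)
case: ltnP => h.
  have hz : n - 2 - i < n by lia.
  have := C x (Ordinal hz) ltac:(move => /=; lia) ltac:(move => /=; lia).
  have := C (Ordinal hz) (Ordinal hll) ltac:(move => /=; lia) ltac:(move => /=; lia).
  have := V (Ordinal hz) ltac:(move => /=; lia).
  move=> /=; lia.
have hz : n.-1 - i < n by lia.
have := C (Ordinal hz) x ltac:(move => /=; lia) ltac:(move => /=; lia).
have := C (Ordinal h0) (Ordinal hz) ltac:(move => /=; lia) ltac:(move => /=; lia).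
have := V (Ordinal hz) ltac:(move => /=; lia).
move=> /=; lia.
Qed.

Lemma tight_swap_gap i (w : 'S_n) p :
  (w (ordS p)).+1 < w p -> tight_swap i (swap_at p * w)%g p.
Proof.
move=> h; rewrite /tight_swap ascent_swap !permM swap_at_l swap_at_r h.
by rewrite (ltn_trans _ h).
Qed.

(** Going back along a descent by at least two lowers [eta_total] by one, so the descent ends at a
    rotation of the decreasing word. *)
Lemma tight_closed_all i (P : 'S_n -> Prop) :
  (forall w, P (rotation n * w)%g -> P w) ->
  (forall u p, tight_swap i u p -> P u -> P (swap_at p * u)%g) ->
  P (descending n) -> forall w, P w.
Proof.
move=> rotP tightP P0 w; have [m] := ubnP (eta_total w 0).
elim: m w => // m IH w hm.
have [[k hk]|[p hp _]] := descending_or_gap w.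
  by apply: (rotation_exp_closed rotP (k := k)); rewrite hk.
rewrite -(swap_at_mulK p w); apply: tightP; first exact: tight_swap_gap.
apply: IH.
have := @eta_total_swap_gap n (swap_at p * w)%g p 0 hn.
rewrite swap_at_mulK !permM swap_at_l swap_at_r => /(_ hp isT); lia.
Qed.

(** Swapping an ascent that does not wrap around lowers the sum of [x * w x]; the process stops at
    the decreasing word. *)
Lemma linear_sort (Z : 'S_n -> Prop) :
  (forall u p, ascent u p -> Z (swap_at p * u)%g -> Z u) ->
  Z (descending n) -> forall w, Z w.
Proof.
move=> Zpred Z0 w.
have [m] := ubnP (\sum_(x < n) x * w x); elim: m w => // m IH w hm.
case: (pickP (fun p : 'I_n => (p.+1 < n) && ascent w p)) => [p /andP[hp asc]|H].
  apply: (Zpred w p asc); apply: IH; move: hm; rewrite ltnS; apply: leq_trans.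
  have ps : ordS p != p by apply: ordS_neq; lia.
  rewrite (bigD1 p) // (bigD1 (ordS p)) //= [X in _ < X](bigD1 p) // [X in _ < _ + X](bigD1 (ordS p)) //=.
  rewrite !permM swap_at_l swap_at_r.
  under eq_bigr => x /andP[h1 h2] do
    rewrite permM swap_atE (negPf h1) (negPf h2).
  move: asc; rewrite /ascent.
  rewrite !addnA ltn_add2r modn_small // !mulSn; lia.
rewrite (descendingP (w := w)) //; first lia.
by move=> p hp; have := H p; rewrite hp /= => ->.
Qed.

(** Predecessors lead from the given word to a rotation of the decreasing word, and from there to
    every word. *)
Lemma pred_closed_all (Z : 'S_n -> Prop) :
  (forall u p, ascent u p -> Z (swap_at p * u)%g -> Z u) ->
  (exists w, Z w) -> forall w, Z w.
Proof.
move=> Zpred [w0 Zw0].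
have [v [k [Zv hv]]] : exists v k, Z v /\ (rotation n ^+ k * v)%g = descending n.
  have [m] := ubnP (eta_total w0 0); elim: m w0 Zw0 => // m IH w0 Zw0 hm.
  have [[k hk]|[p hp _]] := descending_or_gap w0; first by exists w0, k.
  apply: (IH (swap_at p * w0)%g).
    apply: (Zpred _ p); last by rewrite swap_at_mulK.
    by rewrite ascent_swap; apply: ltn_trans hp.
  have := @eta_total_swap_gap n (swap_at p * w0)%g p 0 hn.
  rewrite swap_at_mulK !permM swap_at_l swap_at_r => /(_ hp isT); lia.
elim: k Z v Zpred Zv hv {w0 Zw0} => [|k IH] Z v Zpred Zv hv.
  by apply: linear_sort Zpred _; rewrite -hv mul1g.
(* [Z] need not be invariant under rotation; translating it by one rotation shortens the exponent
   [k]. *)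
pose Z' w := Z ((rotation n)^-1 * w)%g.
have Z'all : forall w, Z' w.
  apply: (IH Z' (rotation n * v)%g); rewrite /Z' ?mulKg //; last by rewrite mulgA -expgSr.
  move=> u p asc h; apply: (Zpred _ (ordS p)).
    by rewrite -ascent_rotation mulKVg.
  suff -> : (swap_at (ordS p) * ((rotation n)^-1 * u) = (rotation n)^-1 * (swap_at p * u))%g by [].
  apply: (mulgI (rotation n)).
  by rewrite mulKVg mulgA -swap_at_rotation -!mulgA mulKVg.
by move=> w; have := Z'all (rotation n * w)%g; rewrite /Z' mulKg.
Qed.

End Cyclic.

Local Open Scope ring_scope.

(** * Multiline queues *)

Ltac simp_order := repeat match goal with
  | |- context [minn ?a ?b] =>
      first [ rewrite [minn a b](_ : _ = a); last lia | rewrite [minn a b](_ : _ = b); last lia ]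
  | |- context [if (?a < ?b)%N then _ else _] =>
      first [ rewrite [(a < b)%N](_ : _ = true); last lia | rewrite [(a < b)%N](_ : _ = false); last lia ]
  end.

(** * The two-site identity between weights *)

Section ScalarExchange.
Variables (R : comPzRingType) (x wt : nat -> R) (total : R) (m : nat).
Hypothesis x_wt : forall c, (c <= m)%N -> x c * wt c = total.

(* [serve b c] is the weight of a site emitting [b] when [c] is the best waiting
   class, and [hat] its companion in the telescoping relation. [c1] and [c2] are
   the two best classes waiting on entry; the incoming letters [a2], then [a1],
   meet sites emitting [b2], then [b1]. *)
Definition jump (a b : nat) : R := if (a < b)%N then x a else 0.
Definition serve (b c : nat) : R := if b == m.+1 then wt c else (b == c)%:R.
Definition hat (b : nat) : R := if b == m.+1 then total else 0.

Variables (c1 c2 : nat).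
Definition after (a b : nat) : nat :=
  if b == m.+1 then minn c1 a else if (a < c1)%N then c1 else minn c2 a.
Definition serve2 (a1 a2 b1 b2 : nat) : R :=
  serve b2 (minn c1 a2) * serve b1 (minn a1 (after a2 b2)).

(** The hat relation: jumps in the lower word [b] and in the upper word [a] differ by two hat terms,
    which cancel around the ring. The proof splits on which sites emit [m.+1] and on the order of
    the classes. *)
Lemma serve2_exchange a1 a2 b1 b2 :
  (c1 <= m)%N -> (c2 <= m)%N -> (a1 <= m)%N -> (a2 <= m)%N ->
  (c1 < c2)%N || (c1 == m) && (c2 == m) ->
  (a1 < m)%N ==> (a1 != c1) && (a1 != c2) && (a1 != a2) ->
  (a2 < m)%N ==> (a2 != c1) && (a2 != c2) && (a1 != a2) ->
  jump b2 b1 * serve2 a1 a2 b2 b1 - jump b1 b2 * serve2 a1 a2 b1 b2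
  - jump a1 a2 * (serve2 a2 a1 b1 b2 - serve2 a1 a2 b1 b2) =
  serve b2 (minn c1 a2) * hat b1 - hat b2 * serve b1 (minn a1 (minn c1 a2)).
Proof.
move=> hc1 hc2 ha1 ha2 hc h1 h2.
have jV b : (b <= m)%N -> jump b m.+1 = x b by rewrite /jump ltnS => ->.
have jV' b : (b <= m)%N -> jump m.+1 b = 0 by rewrite /jump ltnNge => /leqW ->.
have jVV : jump m.+1 m.+1 = 0 by rewrite /jump ltnn.
have big b c : (m.+1 < b)%N -> (c <= m)%N -> serve b c = 0.
  rewrite /serve => hb hcm; have -> : (b == m.+1) = false by lia.
  by have -> : (b == c) = false by lia.
have sV c : serve m.+1 c = wt c by rewrite /serve eqxx.
have hV : hat m.+1 = total by rewrite /hat eqxx.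
have hN b : b != m.+1 -> hat b = 0 by rewrite /hat => /negPf ->.
have aV a : after a m.+1 = minn c1 a by rewrite /after eqxx.
have sN b c : b != m.+1 -> serve b c = (b == c)%:R by rewrite /serve => /negPf ->.
have aN a b : b != m.+1 -> after a b = if (a < c1)%N then c1 else minn c2 a.
  by rewrite /after => /negPf ->.
have xw c : (c <= m)%N -> wt c * x c = total by move=> /x_wt; rewrite mulrC.
rewrite /serve2.
have [->|n1] := eqVneq b1 m.+1; have [->|n2] := eqVneq b2 m.+1.
{ rewrite jVV !sV hV !aV /jump.
  have [k1|k1] := leqP c1 a1; have [k2|k2] := leqP c1 a2; have [k3|k3] := leqP a2 a1.
  all: try (exfalso; lia).
  all: simp_order; ring: (xw _ ha1). }
{ have [bb|bb] := leqP b2 m; last first.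
    rewrite !(big b2) ?(hN b2) //; try lia; ring.
  rewrite jV // jV' // !sV hV (hN b2) // !aV !sN // !aN // {1}/jump.
  (* Under the indicator [x b2] becomes [x c], which combines with [wt c] into [total]. *)
  have xd c : x b2 * (b2 == c)%:R = x c * (b2 == c)%:R.
    by case: eqP => [->//|_]; rewrite !mulr0.
  have xwd c : (c <= m)%N -> wt c * (x b2 * (b2 == c)%:R) = total * (b2 == c)%:R.
    by move=> h; rewrite xd mulrA xw.
  have [k1|k1] := leqP c1 a1; have [k2|k2] := leqP c1 a2; have [k3|k3] := leqP a2 a1;
  have [k4|k4] := leqP c2 a1; have [k5|k5] := leqP c2 a2.
  all: try (exfalso; lia).
  all: simp_order.
  all: first [rewrite [x b2 * _]mulrCA xwd //; ring
    | ring: (xw _ ha1) (xw _ ha2) (xw _ hc1) (xw _ hc2) (xd a1) (xd a2) (xd c1) (xd c2)]. }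
{ have [bb|bb] := leqP b1 m; last first.
    rewrite !(big b1) ?(hN b1) //; try lia; ring.
  rewrite jV // jV' // !sV hV (hN b1) // !aV !sN // {1}/jump.
  have xd c : x b1 * (b1 == c)%:R = x c * (b1 == c)%:R.
    by case: eqP => [->//|_]; rewrite !mulr0.
  have xwd c : (c <= m)%N -> wt c * (x b1 * (b1 == c)%:R) = total * (b1 == c)%:R.
    by move=> h; rewrite xd mulrA xw.
  rewrite !aN //.
  have [k1|k1] := leqP c1 a1; have [k2|k2] := leqP c1 a2; have [k3|k3] := leqP a2 a1;
  have [k4|k4] := leqP c2 a1; have [k5|k5] := leqP c2 a2.
  all: try (exfalso; lia).
  all: simp_order.
  all: first [rewrite [x b1 * _]mulrCA xwd //; ring
    | ring: (xw _ ha1) (xw _ ha2) (xw _ hc1) (xw _ hc2) (xd a1) (xd a2) (xd c1) (xd c2)]. }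
rewrite !hN // mulr0 mul0r subrr !sN // !aN //.
(* The indicators turn a jump between emitted letters into one between served classes, so only the
   order of the classes matters. *)
have jd a b c d : jump a b * ((b == c)%:R * (a == d)%:R) = jump d c * ((b == c)%:R * (a == d)%:R).
  by case: eqP => [->|_]; case: eqP => [->|_]; rewrite ?mul0r ?mulr0.
rewrite !jd /jump.
have [k1|k1] := leqP c1 a1; have [k2|k2] := leqP c1 a2; have [k3|k3] := leqP a2 a1;
have [k4|k4] := leqP c2 a1; have [k5|k5] := leqP c2 a2.
all: try (exfalso; lia).
all: simp_order.
all: ring.
Qed.
End ScalarExchange.

(** * Queues as sets of waiting classes *)

Section QueueSets.
Local Open Scope nat_scope.
Variables (n m : nat).
Implicit Types (Q S : {set 'I_n}) (a b : 'I_n).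

(** The minimum capped at [m], written through a maximum so that the empty queue yields the default
    class [m]. *)
Definition queue_min Q : nat := m - \max_(a in Q) (m - a).
Definition arrive Q a : {set 'I_n} := if a < m then a |: Q else Q.
Definition depart Q (b : nat) : {set 'I_n} := [set a in Q | a != b :> nat].
Definition waiting Q : bool := [forall a in Q, a < m].

Lemma queue_min_le Q : queue_min Q <= m.
Proof. exact: leq_subr. Qed.

Lemma waitingP Q : reflect (forall a, a \in Q -> a < m) (waiting Q).
Proof. exact: (iffP forall_inP). Qed.

Lemma queue_min_lb Q a : a \in Q -> a < m -> queue_min Q <= a.
Proof.
move=> aQ am; rewrite /queue_min.
have := @leq_bigmax_cond _ (mem Q) (fun a : 'I_n => m - a) a aQ.
by rewrite /=; lia.
Qed.

Lemma queue_min_in Q : queue_min Q < m -> exists2 a, a \in Q & a = queue_min Q :> nat.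
Proof.
rewrite /queue_min => h.
have [Q0|[a0 a0Q]] := set_0Vmem Q; first by move: h; rewrite Q0 big_set0 subn0 ltnn.
have Qpos : 0 < #|Q| by apply/card_gt0P; exists a0.
have [a aQ e] := eq_bigmax_cond (fun a : 'I_n => m - a) Qpos.
by exists a => //; move: h; rewrite e; lia.
Qed.

Lemma queue_min_set0 : queue_min set0 = m.
Proof. by rewrite /queue_min big_set0 subn0. Qed.

Lemma queue_min_eq_set0 Q : waiting Q -> queue_min Q = m -> Q = set0.
Proof.
move=> /waitingP W e; apply/setP => a; rewrite inE; apply/negP => aQ.
by have := queue_min_lb aQ (W _ aQ); have := W _ aQ; lia.
Qed.

Lemma queue_min_arrive Q a : a <= m -> (a < m) ==> (a \notin Q) ->
  queue_min (arrive Q a) = minn a (queue_min Q).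
Proof.
rewrite /arrive; case: ltnP => am ha /=; last by have := queue_min_le Q; lia.
by move=> aQ; rewrite /queue_min big_setU1 //=; lia.
Qed.

Lemma in_depart Q k a : (a \in depart Q k) = (a \in Q) && (a != k :> nat).
Proof. by rewrite inE. Qed.

Lemma in_arrive Q b a : (a \in arrive Q b) = (b < m) && (a == b) || (a \in Q).
Proof. by rewrite /arrive; case: ifP => //= _; rewrite !inE. Qed.

Lemma waiting_arrive Q a : waiting Q -> waiting (arrive Q a).
Proof.
move=> /waitingP W; apply/waitingP => b; rewrite in_arrive.
by case/orP => [/andP[am /eqP->]|/W].
Qed.

Lemma waiting_depart Q k : waiting Q -> waiting (depart Q k).
Proof. by move=> /waitingP W; apply/waitingP => a; rewrite in_depart => /andP[/W]. Qed.

Lemma departC Q k l : depart (depart Q k) l = depart (depart Q l) k.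
Proof. by apply/setP => a; rewrite !in_depart andbAC. Qed.

Lemma arriveC Q a b : arrive (arrive Q a) b = arrive (arrive Q b) a.
Proof. by apply/setP => c; rewrite !in_arrive orbCA. Qed.

Lemma depart_big Q k : waiting Q -> m <= k -> depart Q k = Q.
Proof.
move=> /waitingP W hb; apply/setP => a; rewrite in_depart.
by case aQ : (a \in Q) => //=; have := W _ aQ; lia.
Qed.

(** Stored classes are distinct, so removing the best one raises the minimum, unless nothing is
    stored and [m] is served repeatedly. *)
Lemma queue_min_depart Q : waiting Q ->
  let c1 := queue_min Q in let c2 := queue_min (depart Q c1) in
  (c1 < c2) || (c1 == m) && (c2 == m).
Proof.
move=> W /=; set c1 := queue_min Q; set c2 := queue_min _.
have := queue_min_le Q; rewrite leq_eqVlt -/c1 => /orP[/eqP e|lt].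
  have Q0 := queue_min_eq_set0 W e.
  by rewrite /c2 e Q0 depart_big ?queue_min_set0 ?eqxx ?orbT // -Q0.
have := queue_min_le (depart Q c1); rewrite -/c2 leq_eqVlt => /orP[/eqP ->|h2].
  by rewrite lt.
have [a] := queue_min_in h2; rewrite in_depart -/c2 => /andP[aQ ne] e.
by have := queue_min_lb aQ (waitingP _ W _ aQ); rewrite -/c1; lia.
Qed.

(* [c1] and [c2] are the two best classes waiting before [a] arrives; serving
   the best of them and [a] leaves [after c1 c2 a b]. *)
Lemma queue_min_serve Q a b : waiting Q -> a <= m -> (a < m) ==> (a \notin Q) ->
  let c1 := queue_min Q in let c2 := queue_min (depart Q c1) in
  b = m.+1 :> nat \/ b = minn c1 a :> nat ->
  queue_min (depart (arrive Q a) b) = after m c1 c2 a b.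
Proof.
move=> W am aQ c1 c2 [e|e]; rewrite /after.
  rewrite e eqxx depart_big ?leqnSn //; last exact: waiting_arrive.
  by rewrite queue_min_arrive // minnC.
have c1m : c1 <= m := queue_min_le Q.
have -> : (b == m.+1 :> nat) = false by lia.
case: ltnP => h.
  have am' : a < m by lia.
  rewrite am' /= in aQ.
  congr queue_min; apply/setP => c; rewrite in_depart in_arrive am' /=.
  have -> : b = a by apply: ord_inj; lia.
  rewrite -[c != a :> nat]/(c != a).
  by case: eqP => [->|_]; rewrite ?(negPf aQ) ?andbT.
have eb : b = c1 :> nat by lia.
have [am'|am'] := ltnP a m; last first.
  have c1m' : queue_min Q <= m by [].
  rewrite /arrive ltnNge am' /= eb -/c2.
  by have := queue_min_le (depart Q c1); rewrite -/c2; lia.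
rewrite am' /= in aQ.
have nab : a != b :> nat.
  apply/eqP => ab; have c1lt : c1 < m by lia.
  have [c cQ ec] := queue_min_in c1lt.
  by move: aQ; have -> : a = c; [apply: ord_inj; rewrite ec -/c1; lia | rewrite cQ].
have -> : depart (arrive Q a) b = arrive (depart Q c1) a.
  apply/setP => c; rewrite in_depart !in_arrive in_depart am' eb /=.
  by case: eqP => // ->; rewrite -eb nab.
rewrite queue_min_arrive ?am' //=; first by rewrite minnC.
by rewrite in_depart (negPf aQ).
Qed.

End QueueSets.

(** Summation over one coordinate first; functions with value [t0] at [i] represent the choices of
    the others. *)
Lemma sum_update (I T : finType) (R : nmodType) (i : I) (t0 : T) (F : {ffun I -> T} -> R) :
  let upd (f : {ffun I -> T}) t := [ffun j => if j == i then t else f j] in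
  \sum_f F f = \sum_(f : {ffun I -> T} | f i == t0) \sum_t F (upd f t).
Proof.
move=> upd.
rewrite (partition_big (fun f => upd f t0) (fun f : {ffun I -> T} => f i == t0)) /=; last first.
  by move=> f _; rewrite ffunE eqxx.
apply: eq_bigr => f /eqP fi.
rewrite (reindex_onto (upd f) (fun g : {ffun I -> T} => g i)) /=.
  apply: eq_bigl => t; rewrite [upd f t i]ffunE !eqxx andbT; apply/eqP/ffunP => j.
  by rewrite !ffunE; case: eqP => // ->.
move=> g /eqP <-; apply/ffunP => j; rewrite !ffunE.
by case: eqP => // ->.
Qed.

(** * One layer at two adjacent sites *)

Section Layer.
Variables (n : nat) (R : comPzRingType) (x : nat -> R) (m : nat).
Implicit Types (Q : {set 'I_n}) (a b : 'I_n) (v w : {ffun 'I_n -> 'I_n}).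
Implicit Types (F : {ffun 'I_n -> {set 'I_n}}).

(** This is [vacancy_total / x c] without division. *)
Definition vacancy_wt (c : nat) : R := \prod_(j < m.+1 | j != c :> nat) x j.
Definition vacancy_total : R := \prod_(j < m.+1) x j.

Lemma x_vacancy_wt c : (c <= m)%N -> x c * vacancy_wt c = vacancy_total.
Proof.
rewrite -ltnS => hc; rewrite /vacancy_total (bigD1 (Ordinal hc)) //=.
Qed.

(* The queue [Q] arrives at a site from the right, takes up the letter [a] of the
   upper word and leaves as [Q'] to the left. The site emits the best waiting
   class, or [m.+1] if it offers no service. Class [m] is in unlimited supply and
   never stored; a stored class does not arrive a second time. *)
Definition ready Q a := [&& waiting m Q, (a <= m)%N & (a < m)%N ==> (a \notin Q)].

Definition site_wt Q a b Q' : R :=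
  if ready Q a && (Q' == depart (arrive m Q a) b)
  then serve vacancy_wt m b (queue_min m (arrive m Q a)) else 0.

Definition site_hat Q a b Q' : R :=
  if ready Q a && (Q' == depart (arrive m Q a) b) then hat vacancy_total m b else 0.

Lemma serve_neq0 b Q : serve vacancy_wt m b (queue_min m Q) != 0 ->
  b = m.+1 :> nat \/ b = queue_min m Q :> nat.
Proof.
rewrite /serve; case: (nat_of_ord b =P _) => [|_]; first by left.
by case: (nat_of_ord b =P _) => [|_]; [right | rewrite eqxx].
Qed.

Section TwoSites.
Variables (Q0 : {set 'I_n}).
Let c1 := queue_min m Q0.
Let c2 := queue_min m (depart Q0 c1).

Let final a1 a2 b1 b2 := depart (depart (arrive m (arrive m Q0 a2) a1) b2) b1.

(** An arriving [a1] below [m] is not yet waiting, so it is not the class [b2] served just before,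
    and the two events commute. *)
Let arrive_depart a1 a2 b2 : ready Q0 a1 -> ready Q0 a2 -> ((a1 < m)%N ==> (a1 != a2)) ->
  b2 = m.+1 :> nat \/ b2 = queue_min m (arrive m Q0 a2) :> nat ->
  [/\ ready (depart (arrive m Q0 a2) b2) a1,
      arrive m (depart (arrive m Q0 a2) b2) a1 = depart (arrive m (arrive m Q0 a2) a1) b2
    & queue_min m (arrive m (depart (arrive m Q0 a2) b2) a1) = minn a1 (after m c1 c2 a2 b2)].
Proof.
move=> /and3P[W a1m n1] /and3P[_ a2m n2] n12 hb.
have fresh : (a1 < m)%N ==> (a1 \notin arrive m Q0 a2).
  apply/implyP => h; rewrite h /= in n1 n12.
  by rewrite in_arrive (negPf n12) andbF.
have rd : ready (depart (arrive m Q0 a2) b2) a1.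
  rewrite /ready waiting_depart ?waiting_arrive // a1m /=.
  by apply/implyP => h; rewrite in_depart negb_and (implyP fresh h).
split=> //.
  apply/setP => c; move: (arrive m Q0 a2) fresh hb => R2 fresh hb; rewrite in_arrive !in_depart in_arrive.
  case: (ltnP a1 m) => h //=; case: (c =P a1) => //= ->; apply/esym.
  rewrite h /= in fresh; apply/eqP => e; have eb : a1 = b2 by apply: ord_inj.
  case: hb => [hb|hb]; first by move: hb; rewrite -eb; lia.
  have := @queue_min_in n m R2; rewrite -hb -eb => /(_ h) [c' hc ec].
  by move: fresh; have -> : a1 = c' by [apply: ord_inj]; rewrite hc.
case/and3P: rd => _ _ rd; rewrite queue_min_arrive //; congr minn.
apply: queue_min_serve => //; case: hb => hb; [by left | right].
by rewrite hb queue_min_arrive // minnC.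
Qed.

(** The queue between the two sites is determined by the other data, so at most one term
    survives. *)
Lemma two_sites_wt a1 a2 b1 b2 Q2 :
  ready Q0 a1 -> ready Q0 a2 -> ((a1 < m)%N ==> (a1 != a2)) ->
  \sum_q site_wt Q0 a2 b2 q * site_wt q a1 b1 Q2 =
  (Q2 == final a1 a2 b1 b2)%:R * serve2 vacancy_wt m c1 c2 a1 a2 b1 b2.
Proof.
move=> r1 r2 n12.
rewrite (bigD1 (depart (arrive m Q0 a2) b2)) //= big1 ?addr0; last first.
  by move=> q /negPf nq; rewrite /site_wt nq andbF mul0r.
rewrite {1}/site_wt r2 eqxx /= /serve2.
have e2 : queue_min m (arrive m Q0 a2) = minn c1 a2.
  by case/and3P: r2 => _ h1 h2; rewrite queue_min_arrive // minnC.
have [s0|s0] := eqVneq (serve vacancy_wt m b2 (queue_min m (arrive m Q0 a2))) 0.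
  by rewrite -e2 s0 !mul0r mulr0.
have [rd ad qm] := arrive_depart r1 r2 n12 (serve_neq0 s0).
rewrite /site_wt rd /= qm ad -e2.
by case: eqP => _; rewrite ?mul1r // mul0r mulr0.
Qed.

Lemma wt_hat_sites a1 a2 b1 b2 Q2 :
  ready Q0 a1 -> ready Q0 a2 -> ((a1 < m)%N ==> (a1 != a2)) ->
  \sum_q site_wt Q0 a2 b2 q * site_hat q a1 b1 Q2 =
  (Q2 == final a1 a2 b1 b2)%:R *
    (serve vacancy_wt m b2 (minn c1 a2) * hat vacancy_total m b1).
Proof.
move=> r1 r2 n12.
rewrite (bigD1 (depart (arrive m Q0 a2) b2)) //= big1 ?addr0; last first.
  by move=> q /negPf nq; rewrite /site_wt nq andbF mul0r.
rewrite {1}/site_wt r2 eqxx /=.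
have e2 : queue_min m (arrive m Q0 a2) = minn c1 a2.
  by case/and3P: r2 => _ h1 h2; rewrite queue_min_arrive // minnC.
have [s0|s0] := eqVneq (serve vacancy_wt m b2 (queue_min m (arrive m Q0 a2))) 0.
  by rewrite -e2 s0 !mul0r mulr0.
have [rd ad qm] := arrive_depart r1 r2 n12 (serve_neq0 s0).
rewrite /site_hat rd /= ad -e2.
by case: eqP => _; rewrite ?mul1r // mul0r mulr0.
Qed.

Lemma hat_wt_sites a1 a2 b1 b2 Q2 :
  ready Q0 a1 -> ready Q0 a2 -> ((a1 < m)%N ==> (a1 != a2)) ->
  \sum_q site_hat Q0 a2 b2 q * site_wt q a1 b1 Q2 =
  (Q2 == final a1 a2 b1 b2)%:R *
    (hat vacancy_total m b2 * serve vacancy_wt m b1 (minn a1 (minn c1 a2))).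
Proof.
move=> r1 r2 n12.
rewrite (bigD1 (depart (arrive m Q0 a2) b2)) //= big1 ?addr0; last first.
  by move=> q /negPf nq; rewrite /site_hat nq andbF mul0r.
rewrite {1}/site_hat r2 eqxx /= /hat.
case: (nat_of_ord b2 =P m.+1) => hb; last by rewrite !mul0r mulr0.
have [rd ad qm] := arrive_depart r1 r2 n12 (or_introl hb).
have e2 : after m c1 c2 a2 b2 = minn c1 a2 by rewrite /after hb eqxx.
rewrite /site_wt rd /= qm ad e2.
by case: eqP => _; rewrite ?mul1r // mul0r mulr0.
Qed.

(** Arrivals commute and departures commute, so all sums carry the same indicator of the final
    queue; what remains is [serve2_exchange]. *)
Lemma two_sites_exchange a1 a2 b1 b2 Q2 :
  ready Q0 a1 -> ready Q0 a2 -> ((a1 < m)%N ==> (a1 != a2)) ->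
  jump x b2 b1 * (\sum_q site_wt Q0 a2 b1 q * site_wt q a1 b2 Q2)
  - jump x b1 b2 * (\sum_q site_wt Q0 a2 b2 q * site_wt q a1 b1 Q2)
  - jump x a1 a2 * (\sum_q site_wt Q0 a1 b2 q * site_wt q a2 b1 Q2
                   - \sum_q site_wt Q0 a2 b2 q * site_wt q a1 b1 Q2)
  - (\sum_q site_wt Q0 a2 b2 q * site_hat q a1 b1 Q2
     - \sum_q site_hat Q0 a2 b2 q * site_wt q a1 b1 Q2) = 0.
Proof.
move=> r1 r2 n12.
have n21 : (a2 < m)%N ==> (a2 != a1).
  apply/implyP => h; rewrite eq_sym; apply/negP => /eqP e; move: n12.
  by rewrite e h eqxx.
rewrite !two_sites_wt // wt_hat_sites // hat_wt_sites //.
have -> : final a1 a2 b2 b1 = final a1 a2 b1 b2 by rewrite /final departC.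
have -> : final a2 a1 b1 b2 = final a1 a2 b1 b2 by rewrite /final arriveC.
case: eqP => _; last by rewrite !mul0r; ring.
rewrite !mul1r.
case/and3P: r1 => W a1m f1; case/and3P: r2 => _ a2m f2.
have c1m : (c1 <= m)%N by apply: queue_min_le.
have c2m : (c2 <= m)%N by apply: queue_min_le.
(* A letter that may still arrive is not stored, hence differs from the two best stored classes. *)
have fresh a : (a <= m)%N -> (a < m)%N ==> (a \notin Q0) ->
    (a < m)%N ==> (nat_of_ord a != c1) && (nat_of_ord a != c2).
  move=> am /implyP f; apply/implyP => h; have {}f := f h; apply/andP; split; apply/eqP => e.
    have [c cQ ec] := @queue_min_in n m Q0 ltac:(rewrite -/c1 -e; exact h).
    by move: f; have -> : a = c by [apply: ord_inj; rewrite ec]; rewrite cQ.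
  have [c] := @queue_min_in n m (depart Q0 c1) ltac:(rewrite -/c2 -e; exact h).
  rewrite in_depart -/c2 => /andP[cQ _] ec.
  by move: f; have -> : a = c by [apply: ord_inj; rewrite ec]; rewrite cQ.
have h1 := fresh _ a1m f1; have h2 := fresh _ a2m f2.
rewrite (serve2_exchange x_vacancy_wt) ?subrr //.
- exact: queue_min_depart W.
- by move: h1 n12; case: ltnP => //= _ ->.
- by move: h2 n21; case: ltnP => //= _ ->; rewrite eq_sym.
Qed.

End TwoSites.
End Layer.

(** * Stationarity of multiline queues on the ring *)

Section GlobalLayer.
Variables (n : nat) (hn : (2 < n)%N) (R : comPzRingType) (x : nat -> R).
Local Notation word := {ffun 'I_n -> 'I_n}.
Implicit Types (v w : word) (F : {ffun 'I_n -> {set 'I_n}}).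

Definition exchange (p : 'I_n) v : word := [ffun s => v (swap_at p s)].

Definition valid (m : nat) v : bool :=
  [&& [forall p, (v p <= m)%N],
      [forall p, forall q, (v p == v q) && (v p < m)%N ==> (p == q)] &
      [forall a : 'I_n, (a < m)%N ==> [exists p, v p == a]]].

(* [F s] is the queue leaving site [s] to the left. *)
Definition path_wt (m : nat) v w F : R :=
  \prod_s site_wt x m (F (ordS s)) (v s) (w s) (F s).

Definition path_hat (m : nat) (p : 'I_n) v w F : R :=
  \prod_s (if s == p then site_hat x m else site_wt x m) (F (ordS s)) (v s) (w s) (F s).

(** The ring has no first site from which to compute the queues, so all families of queues are
    summed over. *)
Definition layer_wt m v w : R := \sum_F path_wt m v w F.

Fixpoint mlq (m : nat) (w : word) : R :=
  if m is m'.+1 then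
    if valid m w then \sum_v mlq m' v * layer_wt m' v w else 0
  else [forall p, w p == 0 :> nat]%:R.

(** The combinatorial conditions forced by a nonzero [path_wt] or [path_hat]. *)
Definition compatible m v w F := [forall s,
  [&& ready m (F (ordS s)) (v s),
      F s == depart (arrive m (F (ordS s)) (v s)) (w s) &
      (w s == m.+1 :> nat) || (w s == queue_min m (arrive m (F (ordS s)) (v s)) :> nat)]].

Lemma exchangeK p : involutive (exchange p).
Proof. by move=> v; apply/ffunP => s; rewrite !ffunE swap_atK. Qed.

Lemma exchange_inj p : injective (exchange p).
Proof. exact: inv_inj (exchangeK p). Qed.

Lemma valid_permute m (t : 'S_n) v : valid m [ffun s => v (t s)] = valid m v.
Proof.
suff H (r : 'S_n) u : valid m u -> valid m [ffun s => u (r s)].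
  apply/idP/idP => [h|/H //]; have {h} := H t^-1%g _ h; congr valid.
  by apply/ffunP => s; rewrite !ffunE permKV.
case/and3P => /forallP h1 /forallP h2 /forallP h3; apply/and3P; split.
- by apply/forallP => s; rewrite ffunE.
- apply/forallP => s; apply/forallP => q; rewrite !ffunE.
  by have /forallP/(_ (r q)) := h2 (r s); rewrite (inj_eq perm_inj).
- apply/forallP => a; apply/implyP => ha; have /existsP[s hs] := implyP (h3 a) ha.
  by apply/existsP; exists (r^-1 s)%g; rewrite ffunE permKV.
Qed.

Lemma valid_exchange m p v : valid m (exchange p v) = valid m v.
Proof. exact: valid_permute. Qed.

Lemma site_wt_compatible m Q a b Q' : site_wt x m Q a b Q' != 0 :> R ->
  [&& @ready n m Q a, Q' == depart (arrive m Q a) b &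
   (b == m.+1 :> nat) || (b == queue_min m (arrive m Q a) :> nat)].
Proof.
rewrite /site_wt; case: andP => [[-> ->]|_]; last by rewrite eqxx.
by move=> /(@serve_neq0 n R x m) []->; rewrite eqxx ?orbT.
Qed.

Lemma site_hat_compatible m Q a b Q' : site_hat x m Q a b Q' != 0 :> R ->
  [&& @ready n m Q a, Q' == depart (arrive m Q a) b &
   (b == m.+1 :> nat) || (b == queue_min m (arrive m Q a) :> nat)].
Proof.
rewrite /site_hat; case: andP => [[-> ->]|_]; last by rewrite eqxx.
by rewrite /hat; case: (nat_of_ord b =P m.+1); rewrite ?eqxx.
Qed.

Lemma path_wt_compatible m v w F : path_wt m v w F != 0 -> compatible m v w F.
Proof.
move=> nz; apply/forallP => s; apply: site_wt_compatible; apply: contra_neq nz => e.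
by rewrite /path_wt (bigD1 s) //= e mul0r.
Qed.

Lemma path_hat_compatible m p v w F : path_hat m p v w F != 0 -> compatible m v w F.
Proof.
move=> nz; apply/forallP => s; have [e|ne] := eqVneq s p.
  apply: site_hat_compatible; apply: contra_neq nz => e0.
  by rewrite /path_hat (bigD1 s) //= e eqxx -e e0 mul0r.
apply: site_wt_compatible; apply: contra_neq nz => e0.
by rewrite /path_hat (bigD1 s) //= (negPf ne) e0 mul0r.
Qed.

(* A letter met again on arrival would never leave the queue; but the default
   class [m] is only served when the queue is empty. *)
Lemma compatible_fresh m v w F p :
  valid m v -> (exists s, w s = m :> nat) -> compatible m v w F ->
  (v p < m)%N -> v p \notin F (ordS (ordS p)).
Proof.
case/and3P => _ /forallP inj _ [s0 hs0] /forallP C vp; apply/negP => bad.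
pose G s := (v p \in F (ordS s)) || (s == p).
have step s : G s -> G (ordS s).
  case/orP => [h|/eqP ->]; last by rewrite /G bad.
  have /and3P[_ /eqP e _] := C (ordS s); move: h; rewrite e in_depart in_arrive.
  case/andP => [/orP[/andP[_ /eqP e2]|h] _]; last by rewrite /G h.
  apply/orP; right; have /forallP/(_ (ordS s)) := inj p.
  by rewrite e2 eqxx -e2 vp /= eq_sym.
have all s : G s.
  have [k hk] := rotate_to (1%g : 'S_n) s p; move: hk; rewrite mulg1 perm1 => <-.
  elim: k {s} => [|k IH]; first by rewrite expg0 perm1 /G eqxx orbT.
  by rewrite expgSr permM rotationE; apply: step.
have /and3P[_ _] := C s0; rewrite hs0.
have -> : (m == m.+1) = false by lia.
suff h : v p \in arrive m (F (ordS s0)) (v s0).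
  by have := queue_min_lb h vp; move=> /= h1 /eqP h2; lia.
rewrite in_arrive; case/orP: (all s0) => [->|/eqP ->]; first by rewrite orbT.
by rewrite vp eqxx.
Qed.

Lemma compatible_ready m v w F p :
  valid m v -> (exists s, w s = m :> nat) -> compatible m v w F ->
  ready m (F (ordS (ordS p))) (v p) && ready m (F (ordS (ordS p))) (v (ordS p)).
Proof.
move=> V W C; have /forallP/(_ (ordS p))/and3P[r _ _] := C; rewrite r andbT.
case/and3P: (r) => Wt _ _; rewrite /ready Wt /=.
case/and3P: (V) => /forallP -> _ _ /=; apply/implyP; exact: compatible_fresh C.
Qed.

Section SiteExchange.
Variables (m : nat) (p : 'I_n).
Local Notation z := (ordS p).
Variables (v w : word).
Hypotheses (V : valid m v) (W : exists s, w s = m :> nat).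

Let zp : z != p. Proof. by apply: ordS_neq; lia. Qed.
Let zz : ordS z != z. Proof. by apply: ordS_neq; lia. Qed.

Let outer v' w' F : R := \prod_(s | (s != p) && (s != z))
   site_wt x m (F (ordS s)) (v' s) (w' s) (F s).

Let split_sites (h1 h2 : bool) v' w' F :
  \prod_s (if (h1 && (s == p)) || (h2 && (s == z)) then site_hat x m else site_wt x m)
      (F (ordS s)) (v' s) (w' s) (F s) =
  (if h2 then site_hat x m else site_wt x m) (F (ordS z)) (v' z) (w' z) (F z) *
  (if h1 then site_hat x m else site_wt x m) (F z) (v' p) (w' p) (F p) * outer v' w' F.
Proof.
rewrite (bigD1 p) //= (bigD1 z) //= eqxx andbT [p == z]eq_sym (negPf zp) andbF orbF.
rewrite eqxx andbT andbF orFb -mulrA mulrCA; congr (_ * (_ * _)).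
rewrite /outer; apply: eq_bigr => s /andP[sp sz].
by rewrite (negPf sp) (negPf sz) !andbF.
Qed.

Let path_wtE v' w' F : path_wt m v' w' F =
  site_wt x m (F (ordS z)) (v' z) (w' z) (F z) * site_wt x m (F z) (v' p) (w' p) (F p)
  * outer v' w' F.
Proof. by rewrite -(split_sites false false). Qed.

Let path_hat_lE v' w' F : path_hat m p v' w' F =
  site_wt x m (F (ordS z)) (v' z) (w' z) (F z) * site_hat x m (F z) (v' p) (w' p) (F p)
  * outer v' w' F.
Proof.
rewrite -(split_sites true false) /path_hat; apply: eq_bigr => s _.
by rewrite andTb andFb orbF.
Qed.

Let path_hat_rE v' w' F : path_hat m z v' w' F =
  site_hat x m (F (ordS z)) (v' z) (w' z) (F z) * site_wt x m (F z) (v' p) (w' p) (F p)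
  * outer v' w' F.
Proof. by rewrite -(split_sites false true). Qed.

Let outer_exchange v' w' F : outer (exchange p v') w' F = outer v' w' F.
Proof.
by apply: eq_bigr => s /andP[sp sz]; rewrite ffunE swap_atE (negPf sp) (negPf sz).
Qed.

Let outer_exchange_r v' w' F : outer v' (exchange p w') F = outer v' w' F.
Proof.
by apply: eq_bigr => s /andP[sp sz]; rewrite ffunE swap_atE (negPf sp) (negPf sz).
Qed.

(** The two-site relation times the common factors of all other sites. *)
Lemma site_exchange :
  jump x (w z) (w p) * layer_wt m v (exchange p w) - jump x (w p) (w z) * layer_wt m v w
  - jump x (v p) (v z) * (layer_wt m (exchange p v) w - layer_wt m v w)
  = \sum_F (path_hat m p v w F - path_hat m z v w F).
Proof.
apply/eqP; rewrite -subr_eq0; apply/eqP.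
rewrite /layer_wt -sumrB !mulr_sumr -!sumrB.
(* Sum first over the queue between the two sites. *)
rewrite (sum_update z set0) big1 // => F _.
set upd := fun q => [ffun j => if j == z then q else F j].
have uz q : upd q z = q by rewrite ffunE eqxx.
have up q : upd q p = F p by rewrite ffunE [p == z]eq_sym (negPf zp).
have uzz q : upd q (ordS z) = F (ordS z) by rewrite ffunE (negPf zz).
have ou v' w' q : outer v' w' (upd q) = outer v' w' F.
  apply: eq_bigr => s /andP[sp sz]; rewrite !ffunE (negPf sz).
  by rewrite (inj_eq (can_inj (@ordSK n))) (negPf sp).
have [/andP[r1 r2]|nr] := boolP (ready m (F (ordS z)) (v p) && ready m (F (ordS z)) (v z)).
  have n12 : (v p < m)%N ==> (v p != v z).
    apply/implyP => h; case/and3P: V => _ /forallP/(_ p)/forallP/(_ z) + _.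
    by rewrite h andbT [p == z]eq_sym (negPf zp) implybF.
  have := two_sites_exchange x (w p) (w z) (F p) r1 r2 n12.
  move/(congr1 (fun r => r * outer v w F)); rewrite mul0r => E.
  rewrite -[RHS]E -!sumrB !mulr_sumr -!sumrB mulr_suml.
  apply: eq_bigr => q _.
  rewrite !path_wtE path_hat_lE path_hat_rE !outer_exchange !outer_exchange_r !ou.
  rewrite !uz !up !uzz ![exchange p _ _]ffunE !swap_at_l !swap_at_r.
  by ring.
(* If the entering queue cannot take both letters, every term vanishes. *)
rewrite big1 // => q _.
have zero v' w' : valid m v' -> (exists s, w' s = m :> nat) ->
    ~~ (ready m (F (ordS z)) (v' p) && ready m (F (ordS z)) (v' z)) ->
    path_wt m v' w' (upd q) = 0 /\ forall s, path_hat m s v' w' (upd q) = 0.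
  move=> V' W' nr'; split=> [|s]; apply/eqP; apply: contraNT nr' => nz;
  rewrite -(uzz q); apply: (@compatible_ready m v' w') => //.
    exact: path_wt_compatible.
  exact: path_hat_compatible nz.
have W' : exists s, exchange p w s = m :> nat.
  by case: W => s hs; exists (swap_at p s); rewrite ffunE swap_atK.
have [e1 e2] := zero v w V W nr.
have [e3 _] := zero v (exchange p w) V W' nr.
have [e4 _] := zero (exchange p v) w ltac:(by rewrite valid_exchange) W
  ltac:(by rewrite !ffunE swap_at_l swap_at_r andbC).
by rewrite e1 !e2 e3 e4; ring.
Qed.

End SiteExchange.

Definition balanced (psi : word -> R) := forall w,
  \sum_p (jump x (w (ordS p)) (w p) * psi (exchange p w)
          - jump x (w p) (w (ordS p)) * psi w) = 0.

Lemma mlq_valid m v : ~~ valid m v -> mlq m v = 0.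
Proof.
case: m => [|m] /=; last by move/negPf => ->.
move=> nv; case: forallP => // H; case/negP: nv; apply/and3P; split.
- by apply/forallP => p; rewrite (eqP (H p)).
- by apply/forallP => p; apply/forallP => q; rewrite andbF.
- by apply/forallP => a.
Qed.

Lemma mlq_balanced m : (m < n)%N -> balanced (mlq m).
Proof.
elim: m => [_|m IH mn] w.
  rewrite big1 // => p _ /=.
  have -> : [forall s, exchange p w s == 0 :> nat] = [forall s, w s == 0 :> nat].
    apply/forallP/forallP => H s; last by rewrite ffunE.
    by have := H (swap_at p s); rewrite ffunE swap_atK.
  case: forallP => H; last by rewrite !mulr0 subrr.
  by rewrite /jump (eqP (H p)) (eqP (H (ordS p))) subrr.
rewrite /=; have [V|nV] := boolP (valid m.+1 w); last first.
  by rewrite big1 // => p _; rewrite valid_exchange (negPf nV) !mulr0 subrr.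
have W : exists s, w s = m :> nat.
  case/and3P: (V) => /forallP h1 _ /forallP h3.
  by have /existsP[s /eqP hs] := implyP (h3 (Ordinal (ltnW mn))) (ltnSn m); exists s; rewrite hs.
under eq_bigr => p _ do rewrite valid_exchange V !mulr_sumr -sumrB.
rewrite exchange_big /=.
(* The hats telescope, trading jumps of [w] for jumps of [v]. *)
transitivity (\sum_v \sum_p (mlq m v * (jump x (v p) (v (ordS p)) *
   (layer_wt m (exchange p v) w - layer_wt m v w)))).
  apply: eq_bigr => v _.
  have [Vv|nVv] := boolP (valid m v); last first.
    by rewrite !big1 // => p _; rewrite mlq_valid // !mul0r ?mulr0 ?subrr.
  have tel : \sum_p \sum_F (path_hat m p v w F - path_hat m (ordS p) v w F) = 0.
    rewrite exchange_big big1 // => F _; rewrite sumrB.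
    by rewrite [X in _ - X](reindex_inj (can_inj (@ord_predK n))) /=
       (eq_bigr _ (fun p _ => congr1 (fun q => path_hat m q v w F) (ord_predK p))) subrr.
  have := congr1 (fun r => mlq m v * r) tel; rewrite mulr0 mulr_sumr => E.
  apply/eqP; rewrite -subr_eq0 -sumrB -[X in _ == X]E; apply/eqP; apply: eq_bigr => p _.
  by rewrite -site_exchange //; ring.
rewrite exchange_big /=.
(* Summation by parts: reindexing by [exchange p] moves the difference onto [mlq m], where the
   induction hypothesis applies. *)
transitivity (\sum_v layer_wt m v w * \sum_p (jump x (v (ordS p)) (v p) * mlq m (exchange p v)
          - jump x (v p) (v (ordS p)) * mlq m v)).
  under [RHS]eq_bigr => v _ do rewrite mulr_sumr.
  rewrite [RHS]exchange_big; apply: eq_bigr => p _ /=.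
  under eq_bigr => v _ do rewrite mulrBr mulrBr.
  under [RHS]eq_bigr => v _ do rewrite mulrBr.
  rewrite !sumrB; congr (_ - _).
    rewrite (reindex_inj (@exchange_inj p)); apply: eq_bigr => v _ /=.
    rewrite exchangeK !ffunE swap_at_l swap_at_r; ring.
  by apply: eq_bigr => v _; ring.
by rewrite big1 // => v _; rewrite (IH (ltnW mn)) mulr0.
Qed.

End GlobalLayer.

(** * Positivity, rotation invariance and the sorted word *)

Section MlqProperties.
Variables (n : nat) (hn : (2 < n)%N) (R : comPzRingType) (x : nat -> R).
Local Notation word := {ffun 'I_n -> 'I_n}.
Implicit Types (v w : word) (F : {ffun 'I_n -> {set 'I_n}}).

(** The values arise from the [x j] by sums and products alone; this will give nonnegative
    coefficients. *)
Lemma mlq_closed (P : R -> Prop) : P 0 -> P 1 ->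
  (forall a b, P a -> P b -> P (a + b)) -> (forall a b, P a -> P b -> P (a * b)) ->
  (forall j, P (x j)) -> forall m w, P (mlq x m w).
Proof.
move=> P0 P1 PD PM Px; elim=> [|m IH] w /=; first by case: forallP.
case: ifP => // _; apply: big_ind => // v _; apply: (PM) => //.
apply: big_ind => // F _; apply: (big_ind P P1 PM) => s _.
rewrite /site_wt /serve; case: ifP => // _; case: ifP => _; last by case: (_ == _).
exact: (big_ind P P1 PM).
Qed.

Definition rotate_word (T : Type) (f : {ffun 'I_n -> T}) : {ffun 'I_n -> T} :=
  [ffun s => f (ordS s)].

Lemma rotate_word_bij (T : finType) : bijective (@rotate_word T).
Proof.
exists (fun f : {ffun 'I_n -> T} => [ffun s => f (ord_pred s)]) => f; apply/ffunP => s.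
  by rewrite !ffunE ord_predK.
by rewrite !ffunE ordSK.
Qed.

Lemma valid_rotate m v : valid m (rotate_word v) = valid m v.
Proof.
rewrite -[RHS](valid_permute m (rotation n)); congr valid.
by apply/ffunP => s; rewrite !ffunE rotationE.
Qed.

Lemma layer_wt_rotate m v w :
  layer_wt x m (rotate_word v) (rotate_word w) = layer_wt x m v w.
Proof.
rewrite /layer_wt (reindex (@rotate_word {set 'I_n})) /=; last first.
  exact: onW_bij (rotate_word_bij _).
apply: eq_bigr => F _; rewrite /path_wt [RHS](reindex_inj (can_inj (@ordSK n))).
by apply: eq_bigr => s _; rewrite !ffunE.
Qed.

Lemma mlq_rotate m w : mlq x m (rotate_word w) = mlq x m w.
Proof.
elim: m w => [|m IH] w /=.
  congr (nat_of_bool _)%:R; apply/forallP/forallP => H s; last by rewrite ffunE.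
  by have := H (ord_pred s); rewrite ffunE ord_predK.
rewrite valid_rotate; case: ifP => // _.
rewrite (reindex (@rotate_word 'I_n)) /=; last exact: onW_bij (rotate_word_bij _).
by apply: eq_bigr => v _; rewrite IH layer_wt_rotate.
Qed.

Definition sorted_word (m : nat) : word :=
  [ffun s : 'I_n => insubd s (minn s m)].

Lemma sorted_wordE m s : sorted_word m s = minn s m :> nat.
Proof.
by rewrite ffunE val_insubd (leq_ltn_trans (geq_minl _ _)).
Qed.

Lemma valid_sorted m : (m < n)%N -> valid m (sorted_word m).
Proof.
move=> mn; apply/and3P; split.
- by apply/forallP => s; rewrite sorted_wordE geq_minr.
- apply/forallP => s; apply/forallP => t; apply/implyP => /andP[/eqP e h].
  apply/eqP/ord_inj; move/(congr1 (@nat_of_ord n)): e; move: h.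
  by rewrite !sorted_wordE; lia.
- apply/forallP => a; apply/implyP => ha; apply/existsP; exists a.
  by apply/eqP/ord_inj; rewrite sorted_wordE; lia.
Qed.

Lemma arrive_eq0 m (Q : {set 'I_n}) a :
  ready m Q a -> queue_min m (arrive m Q a) = m -> Q = set0 /\ a = m :> nat.
Proof.
move=> /and3P[W am _] /(queue_min_eq_set0 (waiting_arrive a W)) e; split.
  apply/setP => c; have := in_arrive m Q a c; rewrite e !inE.
  by case: (c \in Q); rewrite ?orbT.
have := in_arrive m Q a a; rewrite e inE eqxx andbT; case: ltnP => // h _; lia.
Qed.

(* The empty queue propagates in both directions from the site where the
   default class [m] is served. *)
Lemma compatible_sorted m v F : (m.+1 < n)%N ->
  compatible m v (sorted_word m.+1) F -> v = sorted_word m /\ F = [ffun=> set0].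
Proof.
move=> mn /forallP C.
have Cm (s : 'I_n) : (s < m.+1)%N -> queue_min m (arrive m (F (ordS s)) (v s)) = s :> nat.
  move=> hs; have /and3P[_ _] := C s; rewrite sorted_wordE.
  have -> : minn s m.+1 = s by lia.
  by case/orP => /eqP //; lia.
have up k (hk : (k < n)%N) : (m < k)%N -> F (Ordinal hk) = set0.
  elim: k hk => // k IH hk; have hk' : (k < n)%N by lia.
  have -> : Ordinal hk = ordS (Ordinal hk') by apply: ord_inj; rewrite val_ordS_lt.
  have /and3P[r /eqP e _] := C (Ordinal hk').
  rewrite ltnS leq_eqVlt => /orP[/eqP mk|mk].
    have q : queue_min m (arrive m (F (ordS (Ordinal hk'))) (v (Ordinal hk'))) = m.
      by rewrite Cm //= -mk.
    by have [] := arrive_eq0 r q.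
  suff q : queue_min m (arrive m (F (ordS (Ordinal hk'))) (v (Ordinal hk'))) = m.
    by have [] := arrive_eq0 r q.
  move: e; rewrite (IH hk') // (@depart_big n m); last 2 first.
  - by apply: waiting_arrive; case/and3P: r.
  - by rewrite sorted_wordE /=; lia.
  by move=> <-; rewrite queue_min_set0.
have vup (s : 'I_n) : (m < s)%N -> v s = m :> nat.
  move=> ms; have /and3P[r /eqP e _] := C s.
  suff q : queue_min m (arrive m (F (ordS s)) (v s)) = m by have [] := arrive_eq0 r q.
  move: e; rewrite (@depart_big n m); last 2 first.
  - by apply: waiting_arrive; case/and3P: r.
  - by rewrite sorted_wordE; lia.
  have -> : F s = set0 by have := up _ (ltn_ord s) ms; congr (F _ = _); apply: ord_inj.
  by move=> <-; rewrite queue_min_set0.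
have down j k (hk : (k < n)%N) : (k + j)%N = m ->
    F (Ordinal hk) = set0 /\ v (Ordinal hk) = k :> nat.
  elim: j k hk => [|j IH] k hk kj.
    have km : k = m by lia.
    have /and3P[r /eqP e _] := C (Ordinal hk).
    have q := Cm (Ordinal hk) ltac:(rewrite /= km; exact: leqnn).
    have q' : queue_min m (arrive m (F (ordS (Ordinal hk))) (v (Ordinal hk))) = m.
      by rewrite q.
    have [e1 e2] := arrive_eq0 r q'; split; last by rewrite e2.
    move: e; rewrite e1 => ->; apply/setP => c.
    by rewrite in_depart in_arrive e2 ltnn !inE.
  have hk1 : (k.+1 < n)%N by lia.
  have [F1 _] := IH k.+1 hk1 ltac:(lia).
  have eS : ordS (Ordinal hk) = Ordinal hk1 by apply: ord_inj; rewrite val_ordS_lt.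
  have /and3P[r /eqP e _] := C (Ordinal hk).
  have q := Cm (Ordinal hk) ltac:(move=> /=; lia).
  move: r e q; rewrite eS F1 => r e; case/and3P: (r) => W am ha.
  rewrite queue_min_arrive // queue_min_set0 /= => q.
  have vk : v (Ordinal hk) = k :> nat by lia.
  split=> //; rewrite e; apply/setP => c; rewrite in_depart in_arrive sorted_wordE /= !inE.
  rewrite -(inj_eq (@ord_inj n)) vk orbF; apply/negbTE; rewrite negb_and negbK.
  have -> : minn k m.+1 = k by lia.
  by case: (nat_of_ord c == k); rewrite ?andbF ?orbT.
split; last first.
  apply/ffunP => s; rewrite ffunE; have [ms|ms] := ltnP m s.
    by have := up _ (ltn_ord s) ms; congr (F _ = _); apply: ord_inj.
  by have [] := down (m - s)%N s (ltn_ord s) ltac:(lia); move=> + _; congr (F _ = _); apply: ord_inj.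
apply/ffunP => s; apply: ord_inj; rewrite sorted_wordE; have [ms|ms] := ltnP m s.
  by rewrite vup //; lia.
have [_] := down (m - s)%N s (ltn_ord s) ltac:(lia).
have -> : Ordinal (ltn_ord s) = s by apply: ord_inj.
by move=> ->; lia.
Qed.

(** All queues are empty: sites up to [m] serve their own letter with weight one, and each of the
    [n - m.+1] later sites emits [m.+1] with the weight of a vacancy facing class [m]. *)
Lemma layer_wt_sorted m v : (m.+1 < n)%N ->
  layer_wt x m v (sorted_word m.+1) =
  if v == sorted_word m then (\prod_(j < m) x j) ^+ (n - m.+1) else 0.
Proof.
move=> mn; case: eqP => [->|nv]; last first.
  rewrite /layer_wt big1 // => F _; apply/eqP; apply: contra_notT nv.
  by move=> /path_wt_compatible /(compatible_sorted mn)[].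
rewrite /layer_wt (bigD1 [ffun=> set0]) //= big1 ?addr0; last first.
  move=> F /eqP nF; apply/eqP; apply: contra_notT nF.
  by move=> /path_wt_compatible /(compatible_sorted mn)[].
have site (s : 'I_n) : site_wt x m set0 (sorted_word m s) (sorted_word m.+1 s) set0 =
    if (m < s)%N then \prod_(j < m) x j else 1.
  have W0 : waiting m (set0 : {set 'I_n}) by apply/waitingP => a; rewrite inE.
  have r : ready m (set0 : {set 'I_n}) (sorted_word m s).
    by rewrite /ready W0 sorted_wordE geq_minr inE implybT.
  rewrite /site_wt r queue_min_arrive ?queue_min_set0; last 2 first.
  - by case/and3P: r.
  - by case/and3P: r.
  have -> : set0 == depart (arrive m set0 (sorted_word m s)) (sorted_word m.+1 s).
    apply/eqP/setP => c; rewrite in_depart in_arrive !inE orbF sorted_wordE.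
    apply/esym/negbTE; apply/negP => /andP[/andP[h /eqP ->]].
    by rewrite !sorted_wordE; lia.
  rewrite /= /serve !sorted_wordE ?queue_min_set0; case: (ltnP m s) => h.
    have -> : minn s m.+1 == m.+1 by lia.
    rewrite minnn.
    rewrite /vacancy_wt big_mkcond big_ord_recr /= eqxx mulr1.
    by apply: eq_bigr => j _; rewrite ltn_eqF.
  have -> : (minn s m.+1 == m.+1) = false by lia.
  by have -> : minn s m.+1 == minn s m by lia.
rewrite /path_wt (eq_bigr (fun s : 'I_n => if (m < s)%N then \prod_(j < m) x j else 1)); last first.
  by move=> s _; rewrite -site; congr (site_wt x m _ _ _ _); rewrite ffunE.
rewrite -(big_mkord xpredT (fun s => if (m < s)%N then \prod_(j < m) x j else 1)).
rewrite (big_cat_nat (n := m.+1)) //=; last exact: ltnW.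
rewrite big_nat_cond big1 ?mul1r; last first.
  by move=> s /andP[/andP[_ h] _]; rewrite ltnNge -ltnS h.
rewrite big_nat_cond (eq_bigr (fun=> \prod_(j < m) x j)); last first.
  by move=> s /andP[/andP[h _] _]; rewrite h.
by rewrite -big_nat_cond prodr_const_nat.
Qed.

Lemma mlq_sorted m : (m < n)%N ->
  mlq x m (sorted_word m) = \prod_(k < m) (\prod_(j < k) x j) ^+ (n - k.+1).
Proof.
elim: m => [|m IH] mn.
  rewrite /= big_ord0; case: forallP => // H; exfalso; apply: H => s.
  by rewrite sorted_wordE minn0.
rewrite big_ord_recr /= -(IH (ltnW mn)) valid_sorted //.
rewrite (bigD1 (sorted_word m)) //= big1 ?addr0; last first.
  by move=> v /negPf nv; rewrite layer_wt_sorted // nv mulr0.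
by rewrite layer_wt_sorted // eqxx.
Qed.

End MlqProperties.

Import Order.TTheory Num.Theory.

(** * Order of vanishing *)

(** Coefficient of [t ^ j] after multiplication by [t] when [b] holds. *)
Definition shift_coef (b : bool) (f : nat -> int) (j : nat) : int :=
  if b then (if j is j'.+1 then f j' else 0%R) else f j.

Section Valuation.
Local Open Scope nat_scope.
Variables (n : nat) (hn : 2 < n) (i : nat) (hi : i < n) (c : 'S_n -> nat -> int).
Hypothesis c_ge0 : forall w j, (0 <= c w j)%R.
Hypothesis balance : forall w j,
  (\sum_(p < n) (if ascent w p then shift_coef (w p == i :> nat) (c w) j else 0) =
   \sum_(p < n) (let u := (swap_at p * w)%g in
      if ascent u p then shift_coef (u p == i :> nat) (c u) j else 0))%R.
Hypothesis c_rot : forall w j, c (rotation n * w)%g j = c w j.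
Hypothesis c_low : forall w j, j < eta_exp w i -> c w j = 0%R.
Hypothesis c_neq0 : exists w j, c w j != 0%R.

Let vanishes d := [forall w : 'S_n, [forall j : 'I_(eta_exp w i + d), c w j == 0%R]].

Let vanishesP d : reflect (forall w j, j < eta_exp w i + d -> c w j = 0%R) (vanishes d).
Proof.
apply: (iffP forallP) => H w.
  by move=> j hj; have /forallP /(_ (Ordinal hj)) /eqP := H w.
by apply/forallP => j; apply/eqP/H.
Qed.

Lemma exact_valuation : exists d, forall w,
  (forall j, j < eta_exp w i + d -> c w j = 0%R) /\ c w (eta_exp w i + d) != 0%R.
Proof.
have ex0 : exists d, vanishes d.
  by exists 0; apply/vanishesP => w j; rewrite addn0; exact: c_low.
have [w0 [j0 hw0]] := c_neq0.
have bnd d : vanishes d -> d <= j0.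
  move=> /vanishesP H; rewrite leqNgt; apply/negP => h.
  by move: hw0; rewrite H ?eqxx //; lia.
(* The maximal [d] is the minimum of valuation minus [eta_exp]. *)
case: (ex_maxnP ex0 bnd) => d /vanishesP low dmax {ex0 bnd w0 j0 hw0}.
exists d; pose phi w := c w (eta_exp w i + d).
suff phi_neq0 w : phi w != 0%R by move=> w; split=> [j|]; [exact: low|exact: phi_neq0].
have phi_ge0 w' : (0 <= phi w')%R by exact: c_ge0.
have ex_phi : exists w, phi w != 0%R.
  have /forallPn[v /forallPn[j hj]] : ~~ vanishes d.+1.
    by apply/negP => /dmax; rewrite ltnn.
  exists v; rewrite /phi; suff <- : j = eta_exp v i + d :> nat by [].
  have h1 := ltn_ord j; have : ~~ (j < eta_exp v i + d).
    by apply/negP => /low e; rewrite e eqxx in hj.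
  move: h1; rewrite /=; lia.
(* Balance at order [eta_exp v i + d]. Outgoing swaps of the letter [i] and incoming loose swaps
   involve coefficients of lower order, which vanish. *)
have bal v : (\sum_(p < n) (if ascent v p && (v p != i :> nat) then phi v else 0) =
    \sum_(p < n) (let u := (swap_at p * v)%g in if tight_swap i u p then phi u else 0))%R.
  transitivity (\sum_(p < n) (if ascent v p then
      shift_coef (v p == i :> nat) (c v) (eta_exp v i + d) else 0))%R.
    apply: eq_bigr => p _; case: ifP => /=; case: (ascent v p) => //=.
      by move/negPf => ->.
    move/negbT; rewrite negbK => ->; rewrite /shift_coef.
    by case E : (_ + d) => [|j] //; rewrite low // E.
  rewrite balance; apply: eq_bigr => p _; set u := (swap_at p * v)%g => /=.
  have ev : v = (swap_at p * u)%g by rewrite swap_at_mulK.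
  case asc : (ascent u p); last by rewrite /tight_swap asc.
  case tg : (tight_swap i u p).
    rewrite /shift_coef /phi ev eta_exp_swap_tight //.
    by case: eqP => _; rewrite ?addn1 ?addn0 ?addSn.
  have := eta_exp_swap_loose hn asc (negbT tg); rewrite -ev /shift_coef.
  case: eqP => _; last by rewrite addn0 => h; rewrite low //; lia.
  by case E : (_ + d) => [|j] // h; rewrite low //; lia.
have fwd u p : tight_swap i u p -> phi u != 0%R -> phi (swap_at p * u)%g != 0%R.
  move=> tg nz; apply/negP => /eqP e0; have := bal (swap_at p * u)%g.
  rewrite e0 big1; last by move=> q _; case: ifP.
  move/esym/eqP; rewrite psumr_eq0; last by move=> q _ /=; case: ifP.
  by move/allP => /(_ p (mem_index_enum _)) /=; rewrite swap_at_mulK tg (negPf nz).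
have phi_rot v : phi (rotation n * v)%g = phi v by rewrite /phi c_rot eta_exp_rotation.
pose P : pred 'S_n := fun v => phi v != 0%R.
have rotP v : P (rotation n * v)%g -> P v by rewrite /P phi_rot.
case: ex_phi => v0 Pv0.
have [v1 Pv1 v1min] : exists2 v, P v & forall u, P u -> eta_total v i <= eta_total u i.
  by case: (@arg_minnP _ v0 P (fun v : 'S_n => eta_total v i) Pv0) => v Pv vmin; exists v.
set h := eta_total v1 i in v1min.
(* Sum the balance over the minimal layer. Tight swaps of letters at least [i] would enter from
   below the support, and swaps of letters below [i] stay in the layer and cancel; so no mass leaves
   through letters above [i]. *)
have nohigh v p : P v -> eta_total v i = h -> ascent v p -> v p <= i.
  have sum0 : (\sum_(v | eta_total v i == h)
      \sum_(p < n) (if ascent v p && (i < v p)%N then phi v else 0) = 0)%R.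
    transitivity ((\sum_(v | eta_total v i == h)
        \sum_(p < n) (if ascent v p && (v p != i :> nat) then phi v else 0)) -
      (\sum_(v | eta_total v i == h)
        \sum_(p < n) (if ascent v p && (v p < i)%N then phi v else 0)))%R.
      rewrite -sumrB; apply: eq_bigr => u _ /=; rewrite -sumrB. apply: eq_bigr => q _.
      by case: (ascent u q) => /=; case: (ssrnat.ltngtP (u q) i) => _; rewrite ?subr0 ?subrr.
    apply/eqP; rewrite subr_eq0; apply/eqP.
    transitivity (\sum_(v | eta_total v i == h) \sum_(p < n)
      (let u := (swap_at p * v)%g in if ascent u p && (u p < i)%N then phi u else 0))%R.
      apply: eq_bigr => u /eqP hu; rewrite bal; apply: eq_bigr => q _.
      set u' := (swap_at q * u)%g => /=.
      have eu : u = (swap_at q * u')%g by rewrite swap_at_mulK.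
      rewrite /tight_swap; case asc : (ascent u' q) => //=.
      case: (ltnP (u' q) i) => [_|hle]; first by rewrite orbT.
      rewrite orbF; case: ifP => // gap; apply/eqP; apply: contraT => nz.
      have := v1min u' nz; rewrite -hu eu eta_total_swap_gap //; lia.
    rewrite exchange_big [RHS]exchange_big; apply: eq_bigr => q _ /=.
    rewrite (reindex_inj (mulgI (swap_at q))) big_mkcond [RHS]big_mkcond.
    apply: eq_bigr => u _; rewrite swap_at_mulK.
    case: (boolP (ascent u q && (u q < i))) => [/andP[asc lt]|_]; last by rewrite !if_same.
    by rewrite eta_total_swap_low.
  move=> Pv hv asc; rewrite leqNgt; apply/negP => lt.
  have pos u q : (0 <= if ascent u q && (i < u q)%N then phi u else 0)%R by case: ifP.
  move/eqP: sum0; rewrite psumr_eq0; last by move=> u _; apply: sumr_ge0.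
  move/allP => /(_ v (mem_index_enum _)); rewrite hv eqxx /= psumr_eq0 //.
  move/allP => /(_ p (mem_index_enum _)) /=.
  by rewrite asc lt /= (negPf Pv).
pose pos (v : 'S_n) : 'I_n := (v^-1)%g (Ordinal hi).
have posE (v : 'S_n) : v (pos v) = i :> nat by rewrite /pos permKV.
(* Pushes the letters below [i] to the right until they are blocked by [i]; a
   larger letter must weigh less because exchanging two of them moves the
   larger one back. *)
pose push (v : 'S_n) := \sum_(x < n) (i - v x) * cdist (pos v) x.
pose Q : pred 'S_n := fun v => P v && (eta_total v i == h).
have Qv1 : Q v1 by rewrite /Q Pv1 eqxx.
have [v2 /andP[Pv2 /eqP hv2] v2max] : exists2 v, Q v & forall u, Q u -> push u <= push v.
  by case: (@arg_maxnP _ v1 Q push Qv1) => v Qv vmax; exists v.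
(* Any other ascent would be a tight swap inside the layer that increases [push]. *)
have v2asc p : ascent v2 p -> v2 p = i :> nat \/ v2 (ordS p) = i :> nat.
  move=> asc; case: (eqVneq (v2 p : nat) i) => [|n1]; first by left.
  case: (eqVneq (v2 (ordS p) : nat) i) => [|n2]; first by right.
  have lt : v2 p < i by have := nohigh _ _ Pv2 hv2 asc; lia.
  have /v2max : Q (swap_at p * v2)%g.
    rewrite /Q eta_total_swap_low // hv2 eqxx andbT; apply: fwd => //.
    by rewrite /tight_swap asc lt orbT.
  have nqp : pos v2 != p by rewrite -(perm_val_eq v2) posE eq_sym.
  have nqs : pos v2 != ordS p by rewrite -(perm_val_eq v2) posE eq_sym.
  have -> : push (swap_at p * v2)%g =
      \sum_(x < n) (i - v2 x) * cdist (pos v2) (swap_at p x).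
    rewrite /push (reindex_inj (@perm_inj _ (swap_at p))); apply: eq_bigr => x _.
    rewrite permM swap_atK; congr (_ * cdist _ _).
    apply: (@perm_inj _ (swap_at p * v2)%g); apply: ord_inj.
    by rewrite posE permM swap_atE (negPf nqp) (negPf nqs) posE.
  have ps : ordS p != p by apply: ordS_neq; lia.
  rewrite /push (bigD1 p) // (bigD1 (ordS p)) //= [X in _ <= X](bigD1 p) //.
  rewrite [X in _ <= _ + X](bigD1 (ordS p)) //= swap_at_l swap_at_r.
  under eq_bigr => x /andP[h1 h2] do rewrite swap_atE (negPf h1) (negPf h2).
  rewrite !addnA leq_add2r.
  have -> : cdist (pos v2) (ordS p) = (cdist (pos v2) p).+1.
    rewrite !cdistE; move: (val_ordS p) nqp nqs; rewrite -!val_eqE /=.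
    move: (ltn_ord p) (ltn_ord (pos v2)).
    by case: (p.+1 =P n) => e h1 h2 /= -> ? ?; case: ifP => ?; case: ifP => ?; lia.
  move: asc; rewrite /ascent !mulnS; lia.
have [k hk] := rotate_displaced hn hi v2asc.
have Pk : P (rotation n ^+ k * v2)%g by exact: (rotation_exp_closed_inv rotP k Pv2).
move: (_ * v2)%g hk Pk => v3 d3 Pv3.
(* The letter [i] travels left by tight swaps to its place in the decreasing word. *)
have down m : m <= i -> exists2 v, displaced i (n.-1 - m) v & P v.
  elim: m => [_|m IH hm]; first by exists v3; rewrite ?subn0.
  have [v dv Pv] := IH (ltnW hm).
  have [||||p tg dp] := @displaced_step n hn i (n.-1 - m.+1) v; try lia.
    by have <- : n.-1 - m = (n.-1 - m.+1).+1 by lia.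
  by exists (swap_at p * v)%g => //; apply: fwd.
have [v dv Pv] := down i (leqnn i).
apply: (tight_closed_all hn rotP fwd).
by rewrite -(displaced_descending hn hi dv).
Qed.

End Valuation.

(** * Uniqueness *)

Section HomogeneousKernel.
Variables (n : nat) (hn : (2 < n)%N) (y : 'S_n -> rat).
Hypothesis y1 : y 1%g = 0.
Hypothesis balance : forall w : 'S_n, w != 1%g ->
  y w * (\sum_(p < n) (ascent w p)%:R) =
  \sum_(p < n) y (swap_at p * w)%g * (ascent (swap_at p * w)%g p)%:R.

(* Summing [|y w| out(w) <= sum |y u| rate(u, w)] over all [w] gives an equality,
   hence equality everywhere: the zero set of [y] is closed under predecessors. *)
Lemma homogeneous_kernel w : y w = 0.
Proof.
pose excess (w : 'S_n) : rat :=
  \sum_(p < n) `|y (swap_at p * w)%g| * (ascent (swap_at p * w)%g p)%:R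
  - `|y w| * (\sum_(p < n) (ascent w p)%:R).
have excess_ge0 v : 0 <= excess v.
  (* No balance is assumed at the identity, but [y] vanishes there. *)
  rewrite subr_ge0; have [->|nv] := eqVneq v 1%g.
    by rewrite y1 normr0 mul0r sumr_ge0 // => p _; rewrite mulr_ge0.
  have -> : `|y v| * (\sum_(p < n) (ascent v p)%:R) =
            `|y v * (\sum_(p < n) (ascent v p)%:R)|.
    by rewrite normrM [X in _ = _ * X]ger0_norm // sumr_ge0.
  rewrite balance // (le_trans (ler_norm_sum _ _ _)) // ler_sum // => p _.
  by rewrite normrM [X in _ * X <= _]ger0_norm.
have sum0 : \sum_v excess v = 0.
  rewrite /excess sumrB exchange_big /=.
  under eq_bigr => p _ do rewrite (reindex_inj (mulgI (swap_at p))) /=.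
  under eq_bigr => p _ do under eq_bigr => v _ do rewrite swap_at_mulK.
  rewrite exchange_big /= -sumrB big1 // => v _.
  by rewrite mulr_sumr subrr.
have excess0 v : excess v = 0.
  move/eqP: sum0; rewrite psumr_eq0 => [/allP/(_ v (mem_index_enum _))/eqP //|].
  by move=> ? _.
move: w; apply: (pred_closed_all hn); last by exists 1%g.
move=> u p asc yu.
move/eqP: (excess0 (swap_at p * u)%g); rewrite /excess yu normr0 mul0r subr0.
rewrite psumr_eq0; last by move=> q _; rewrite mulr_ge0.
move/allP => /(_ p (mem_index_enum _)) /=.
by rewrite swap_at_mulK asc mulr1 normr_eq0 => /eqP.
Qed.
End HomogeneousKernel.

Section Uniqueness.
Variables (n : nat) (hn : (2 < n)%N).

(* The balance matrix with the column of the identity replaced by the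
   normalization. *)
Definition balance_mx : 'M[PolyT n]_#|{: 'S_n}| :=
  \matrix_(a, b) (let u := enum_val a in let w := enum_val b in
    if w == 1%g then (u == 1%g)%:R
    else \sum_(p < n) (u == (swap_at p * w)%g)%:R * rate u p - (u == w)%:R * out_rate w).

Lemma sum_enum_val (R : nmodType) (F : 'S_n -> R) :
  \sum_(a < #|{: 'S_n}|) F (enum_val a) = \sum_w F w.
Proof.
rewrite [RHS](reindex (@enum_val _ {: 'S_n})) //.
exact: onW_bij (enum_val_bij _).
Qed.

Lemma sum_indicator (R : pzSemiRingType) (F G : 'S_n -> R) v :
  \sum_u F u * ((u == v)%:R * G u) = F v * G v.
Proof.
rewrite (bigD1 v) //= eqxx mul1r big1 ?addr0 // => u /negPf ->.
by rewrite mul0r mulr0.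
Qed.

(** Stated for any ring morphism, to serve both the evaluation at [1] and the embedding into
    fractions. *)
Lemma mul_balance_mx (R : comPzRingType) (f : {rmorphism PolyT n -> R})
    (y : 'rV[R]_#|{: 'S_n}|) (b : 'I_#|{: 'S_n}|) :
  (y *m map_mx f balance_mx) 0 b =
  let Y u := y 0 (enum_rank u) in let w := enum_val b in
  if w == 1%g then Y 1%g else
   \sum_(p < n) Y (swap_at p * w)%g * f (rate (swap_at p * w)%g p)
     - Y w * f (out_rate w).
Proof.
rewrite mxE /=.
under eq_bigr => a _ do rewrite !mxE -[X in y 0 X]enum_valK.
rewrite (sum_enum_val (fun u => y 0 (enum_rank u) * f
   (if enum_val b == 1%g then (u == 1%g)%:R
    else \sum_(p < n) (u == (swap_at p * enum_val b)%g)%:R * rate u p -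
         (u == enum_val b)%:R * out_rate (enum_val b)))).
case: eqP => _ /=.
  under eq_bigr => u _ do rewrite rmorph_nat -[_%:R]mulr1.
  by rewrite (sum_indicator _ (fun=> 1)) mulr1.
under eq_bigr => u _ do rewrite (rmorphB f) mulrBr rmorphM rmorph_nat rmorph_sum mulr_sumr.
rewrite sumrB (sum_indicator _ (fun=> f (out_rate (enum_val b)))); congr (_ - _).
rewrite exchange_big; apply: eq_bigr => p _ /=.
under eq_bigr => u _ do rewrite rmorphM rmorph_nat.
by rewrite (sum_indicator _ (fun u => f (rate u p))).
Qed.

Local Notation eval_one := (mmap (intr : int -> rat) (fun=> 1)).

Lemma eval_one_rate (w : 'S_n) p : eval_one (rate w p) = (ascent w p)%:R.
Proof.
rewrite /rate /ascent; case: ifP => _; last by rewrite mmap0.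
by rewrite mmapX mmap1U.
Qed.

(** Setting all variables to [1] gives a matrix with trivial kernel by [homogeneous_kernel]. *)
Lemma det_balance_mx_neq0 : \det balance_mx != 0.
Proof.
apply: contra_neq (oner_neq0 rat) => d0.
have : \det (map_mx eval_one balance_mx) = 0.
  by rewrite det_map_mx d0 rmorph0.
move/eqP/det0P => [y ynz y0]; exfalso; case/negP: ynz; apply/eqP.
have E b := congr1 (fun M : 'rV_ _ => M 0 b) y0.
have H := @homogeneous_kernel n hn (fun w => y 0 (enum_rank w)).
apply/rowP => a; rewrite mxE -[a]enum_valK; apply: H.
  by have := E (enum_rank 1%g); rewrite mul_balance_mx !enum_rankK /= eqxx mxE.
move=> w /negPf nw; have := E (enum_rank w).
rewrite mul_balance_mx !enum_rankK /= nw mxE => /eqP; rewrite subr_eq0 => /eqP.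
rewrite /out_rate rmorph_sum /=.
under eq_bigr do rewrite eval_one_rate.
by under [X in _ = _ * X]eq_bigr do rewrite eval_one_rate.
Qed.

Lemma stationary_unique (psi psi' : 'S_n -> FracT n) :
  is_stationary psi -> is_stationary psi' -> psi 1%g = psi' 1%g -> psi =1 psi'.
Proof.
move=> st st' e1 w.
pose y : 'rV[FracT n]_#|{: 'S_n}| := \row_a (psi (enum_val a) - psi' (enum_val a)).
have y0 : y *m map_mx (@FracField.tofrac _) balance_mx = 0.
  apply/rowP => b; rewrite mul_balance_mx !mxE /=.
  under eq_bigr => p _ do rewrite mxE enum_rankK.
  rewrite !mxE !enum_rankK; case: eqP => _; first by rewrite e1 subrr.
  rewrite mulrBl st st'.
  by under eq_bigr => p _ do rewrite mulrBl; rewrite sumrB subrr.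
(* The adjugate turns this into the determinant times [y]. *)
have : y *m map_mx (@FracField.tofrac _) balance_mx
   *m \adj (map_mx (@FracField.tofrac _) balance_mx) = 0 by rewrite y0 mul0mx.
rewrite -mulmxA mul_mx_adj det_map_mx mul_mx_scalar => /rowP /(_ (enum_rank w)).
rewrite !mxE enum_rankK => /eqP; rewrite mulf_eq0 tofrac_eq0 (negPf det_balance_mx_neq0).
by rewrite subr_eq0 => /eqP.
Qed.

End Uniqueness.

(** * The normalized stationary vector *)

Section Psi.
Variables (n : nat) (hn : (2 < n)%N).

Definition xvar (j : nat) : PolyT n := if insub j is Some o then 'X_o else 0.

Lemma xvarE (o : 'I_n) : xvar o = 'X_o.
Proof. by rewrite /xvar valK. Qed.

Definition word_of (w : 'S_n) : {ffun 'I_n -> 'I_n} := [ffun s => w s].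

(** After [n.-1] layers the default class [n.-1] fills a single site, so valid words are
    permutations. *)
Definition Psi (w : 'S_n) : PolyT n := mlq xvar n.-1 (word_of w).

Lemma jump_rate (w : 'S_n) p : jump xvar (w p) (w (ordS p)) = rate w p.
Proof. by rewrite /jump /rate xvarE. Qed.

Lemma Psi_balance (w : 'S_n) :
  Psi w * out_rate w = \sum_(p < n) Psi (swap_at p * w)%g * rate (swap_at p * w)%g p.
Proof.
have hn1 : (n.-1 < n)%N by lia.
have := @mlq_balanced n hn _ xvar n.-1 hn1 (word_of w).
rewrite sumrB => /eqP; rewrite subr_eq0 => /eqP E.
rewrite /out_rate mulr_sumr; transitivity (\sum_(p < n)
   jump xvar (word_of w p) (word_of w (ordS p)) * mlq xvar n.-1 (word_of w)).
  by apply: eq_bigr => p _; rewrite !ffunE jump_rate mulrC.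
rewrite -E; apply: eq_bigr => p _; rewrite mulrC !ffunE.
have -> : exchange p (word_of w) = word_of (swap_at p * w)%g.
  by apply/ffunP => s; rewrite !ffunE permM.
by rewrite -jump_rate !permM swap_at_l swap_at_r.
Qed.

Lemma Psi_rotation (w : 'S_n) : Psi (rotation n * w)%g = Psi w.
Proof.
rewrite /Psi -[RHS]mlq_rotate; congr mlq; apply/ffunP => s.
by rewrite !ffunE permM rotationE.
Qed.

Lemma Psi_coef_ge0 (w : 'S_n) mm : 0 <= (Psi w)@_mm.
Proof.
pose P (p : PolyT n) := forall mm, 0 <= p@_mm.
apply: (@mlq_closed n _ xvar P) => [k|k|a b Pa Pb k|a b Pa Pb k|j k].
- by rewrite mcoeff0.
- by rewrite mcoeff1.
- by rewrite mcoeffD addr_ge0.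
- by rewrite mcoeffM sumr_ge0 // => h _; rewrite mulr_ge0.
- rewrite /xvar; case: insub => [o|]; last by rewrite mcoeff0.
  by rewrite mcoeffX.
Qed.

Lemma prod_col_triangle (R : comPzSemiRingType) (f : nat -> nat -> R) N :
  \prod_(k < N) \prod_(j < k) f j k = \prod_(j < N) \prod_(k < N | (j < k)%N) f j k.
Proof.
rewrite (exchange_big_dep xpredT) //=; apply: eq_bigr => k _.
by rewrite (big_ord_widen N (fun j => f j k) (ltnW (ltn_ord k))).
Qed.

Lemma prod_triangle_pred (R : comPzSemiRingType) (f : nat -> R) N :
  \prod_(k < N.-1) (\prod_(j < k) f j) ^+ (N - k.+1) =
  \prod_(k < N) \prod_(j < k) f j ^+ (N - k.+1).
Proof.
case: N => [|N]; first by rewrite !big_ord0.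
rewrite big_ord_recr /= subnn [X in _ = _ * X]big1; last first.
  by move=> j _; rewrite expr0.
rewrite mulr1.
by apply: eq_bigr => k _; rewrite prodrXl.
Qed.

Lemma Psi_id : Psi 1%g = psi_id_value n.
Proof.
have hn1 : (n.-1 < n)%N by lia.
have -> : Psi 1%g = mlq xvar n.-1 (sorted_word n n.-1).
  congr mlq; apply/ffunP => s; apply: ord_inj; rewrite sorted_wordE ffunE perm1.
  by move: (ltn_ord s); lia.
rewrite mlq_sorted // /psi_id_value.
rewrite prod_triangle_pred.
rewrite (prod_col_triangle (fun j k => xvar j ^+ (n - k.+1))); apply: eq_bigr => i _.
rewrite !prodrXr xvarE; congr (_ ^+ _).
have rev (F : nat -> nat) : (\sum_(k < n | i < k) F k = \sum_(i.+1 <= k < n) F k)%N.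
  by rewrite [RHS](big_nat_widenl _ 0) // big_mkord.
(* Both exponents add up the integers from [0] to [n - i - 2], in opposite orders. *)
rewrite (rev (fun k => n - k.+1)%N) (rev (fun j => j - i - 1)%N) big_nat_rev big_nat_cond [RHS]big_nat_cond.
by apply: eq_bigr => k /andP[/andP[h1 h2] _]; lia.
Qed.

Lemma a_stat_id k : (k.+1 < n)%N -> a_stat (1%g : 'S_n) k = (n - k.+2)%N.
Proof.
move=> hk; have hk' := ltnW hk.
rewrite (@a_statE _ _ (Ordinal hk) (Ordinal hk')) ?perm1 //.
transitivity #|[set y : 'I_n | (k.+1 < y)%N]|.
  apply: eq_card => y; rewrite !inE perm1; case: ltnP => //= h.
  by rewrite cdist_cyclic -?val_eqE /cyclic_lt /=; lia.
rewrite -sum1_card.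
rewrite (eq_bigl (fun y : 'I_n => k.+1 < y)%N); last by move=> y; rewrite inE.
transitivity (\sum_(k.+2 <= y < n) 1)%N; last by rewrite sum_nat_const_nat muln1.
by rewrite (big_nat_widenl _ 0) // big_mkord.
Qed.

Lemma eta_exp_id (i : 'I_n) : eta_exp (1%g : 'S_n) i = (\sum_(j < n | i < j) (j - i - 1))%N.
Proof.
have -> : (\sum_(j < n | i < j) (j - i - 1) = \sum_(i.+1 <= j < n) (n - j.+1))%N.
  rewrite [RHS]big_nat_rev (big_nat_widenl _ 0) // big_mkord.
  by apply: eq_bigr => j /= h; have := ltn_ord j; lia.
rewrite big_add1 /eta_exp; have [h|h] := leqP i (n - 2).
  rewrite [RHS](big_cat_nat (n := n - 2)) //=; last by lia.
  rewrite [X in (_ = _ + X)%N]big_nat_cond [X in (_ = _ + X)%N]big1 ?addn0; last first.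
    by move=> k /andP[/andP[h1 h2] _]; lia.
  rewrite big_nat_cond [RHS]big_nat_cond; apply: eq_bigr => k /andP[/andP[_ h2] _].
  by rewrite a_stat_id //; lia.
by rewrite !big_geq //; lia.
Qed.

(** * The exponent of one variable *)

Section Exponent.
Variable i : 'I_n.

Definition specialize : PolyT n -> {poly int} :=
  mmap (@polyC int) (fun k => if k == i then 'X else 1).

Lemma specialize_coef p j :
  (specialize p)`_j = \sum_(mm <- msupp p | mm i == j) p@_mm.
Proof.
rewrite /specialize /mmap coef_sum [RHS]big_mkcond; apply: eq_bigr => mm _.
rewrite coefCM.
have -> : mmap1 (fun k => if k == i then 'X else 1) mm = 'X^(mm i) :> {poly int}.
  rewrite /mmap1 (bigD1 i) //= eqxx big1 ?mulr1 // => k /negPf ->.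
  by rewrite expr1n.
by rewrite coefXn eq_sym; case: eqP => _; rewrite ?mulr1 ?mulr0.
Qed.

Lemma specialize_rate (w : 'S_n) p :
  specialize (rate w p) = if ascent w p then (if w p == i then 'X else 1) else 0.
Proof.
rewrite /rate /ascent /specialize; case: ifP => _; last by rewrite mmap0.
by rewrite mmapX mmap1U.
Qed.

Lemma specialize_balance (w : 'S_n) :
  \sum_(p < n) specialize (Psi w) * specialize (rate w p) =
  \sum_(p < n) specialize (Psi (swap_at p * w)%g) * specialize (rate (swap_at p * w)%g p).
Proof.
have := congr1 specialize (Psi_balance w).
rewrite /out_rate mulr_sumr /specialize !rmorph_sum /=.
under eq_bigr do rewrite rmorphM; move=> ->.
by apply: eq_bigr => p _; rewrite rmorphM.
Qed.

Lemma specialize_Psi_id : specialize (Psi 1%g) = 'X^(eta_exp (1%g : 'S_n) i).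
Proof.
rewrite Psi_id eta_exp_id /psi_id_value /specialize rmorph_prod (bigD1 i) //=.
rewrite [X in _ * X]big1 ?mulr1; last first.
  move=> k /negPf nk.
  rewrite rmorph_prod big1 // => j _.
  by rewrite rmorphXn /= mmapX mmap1U nk expr1n.
rewrite rmorph_prod -prodrXr; apply: eq_bigr => j _.
by rewrite rmorphXn /= mmapX mmap1U eqxx.
Qed.

Lemma specialize_Psi_valuation (w : 'S_n) :
  (forall j, (j < eta_exp w i)%N -> (specialize (Psi w))`_j = 0) /\
  (specialize (Psi w))`_(eta_exp w i) != 0.
Proof.
(* Multiplying by ['X^N] provides the lower bound on valuations that [exact_valuation] requires. *)
pose N := (\max_(v : 'S_n) eta_exp v i)%N.
have leN (v : 'S_n) : (eta_exp v i <= N)%N.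
  exact: (@leq_bigmax_cond _ xpredT (fun v : 'S_n => eta_exp v i) v isT).
pose c (v : 'S_n) j := ('X^N * specialize (Psi v))`_j.
have c_ge0 v j : 0 <= c v j.
  rewrite /c coefXnM; case: ifP => // _; rewrite specialize_coef sumr_ge0 // => mm _.
  exact: Psi_coef_ge0.
have coefE v p j : ('X^N * (specialize (Psi v) * specialize (rate v p)))`_j =
    if ascent v p then shift_coef (v p == i :> nat) (c v) j else 0.
  rewrite specialize_rate; case: ifP => _; last by rewrite !mulr0 coef0.
  rewrite -val_eqE /shift_coef; case: eqP => _; last by rewrite mulr1.
  by rewrite mulrA coefMX; case: j.
have balance v j : \sum_(p < n) (if ascent v p then shift_coef (v p == i :> nat) (c v) j else 0) =
   \sum_(p < n) (let u := (swap_at p * v)%g in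
      if ascent u p then shift_coef (u p == i :> nat) (c u) j else 0).
  have := congr1 (fun q : {poly int} => ('X^N * q)`_j) (specialize_balance v).
  rewrite !mulr_sumr !coef_sum.
  under eq_bigr do rewrite coefE; move=> ->.
  by apply: eq_bigr => p _; rewrite coefE.
have c_rot v j : c (rotation n * v)%g j = c v j by rewrite /c Psi_rotation.
have c_low v j : (j < eta_exp v i)%N -> c v j = 0.
  by move=> h; rewrite /c coefXnM (leq_trans h (leN v)).
have c_id j : c 1%g j = (j == N + eta_exp (1%g : 'S_n) i)%N%:R.
  by rewrite /c specialize_Psi_id -exprD coefXn.
have c_neq0 : exists v j, c v j != 0.
  by exists 1%g, (N + eta_exp (1%g : 'S_n) i)%N; rewrite c_id eqxx.
have [d H] := exact_valuation hn (ltn_ord i) c_ge0 balance c_rot c_low c_neq0.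
(* The entry at the identity is a single power of ['X], which fixes [d]. *)
have dN : d = N.
  by have [_] := H 1%g; rewrite c_id pnatr_eq0 eqb0 negbK => /eqP; lia.
have [low nz] := H w; split=> [j hj|].
  have := low (N + j)%N ltac:(lia).
  by rewrite /c coefXnM ltnNge leq_addr addKn.
by move: nz; rewrite dN /c coefXnM ltnNge leq_addl addnK.
Qed.

(** Nonnegative coefficients cannot cancel, so a monomial with a smaller exponent would remain
    visible after specialization. *)
Lemma Psi_exponent_ge (w : 'S_n) mm : mm \in msupp (Psi w) -> (eta_exp w i <= mm i)%N.
Proof.
move=> hm; rewrite leqNgt; apply/negP => h.
have [/(_ _ h) + _] := specialize_Psi_valuation w.
rewrite specialize_coef => /eqP; rewrite psumr_eq0; last by move=> ? _; exact: Psi_coef_ge0.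
move/allP => /(_ mm hm); rewrite eqxx /= => /eqP e0.
by move: hm; rewrite mcoeff_msupp e0 eqxx.
Qed.

Lemma Psi_exponent_eq (w : 'S_n) : exists2 mm, mm \in msupp (Psi w) & mm i = eta_exp w i.
Proof.
have [_] := specialize_Psi_valuation w; rewrite specialize_coef => nz.
have [/hasP[mm hm /eqP e]|/hasPn H] := boolP (has (fun mm : 'X_{1..n} => mm i == eta_exp w i)
  (msupp (Psi w))); first by exists mm.
by move: nz; rewrite big_seq_cond big1 ?eqxx // => mm /andP[/H /negPf ->].
Qed.

End Exponent.

Lemma mdvd_msupp (mm : 'X_{1..n}) (p : PolyT n) :
  mdvd mm p <-> forall m', m' \in msupp p -> (mm <= m')%MM.
Proof.
split=> [[q ->] m'|H].
  by rewrite mulrC (perm_mem (msuppMX _ _)) => /mapP[k _ ->]; apply: lem_addr.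
exists (\sum_(m' <- msupp p) p@_m' *: 'X_[m' - mm]).
rewrite mulr_sumr {1}[p]mpolyE big_seq [RHS]big_seq; apply: eq_bigr => m' hm'.
by rewrite -scalerAr -mpolyXD addmC submK // H.
Qed.

(** Divisibility is tested on the support, one variable at a time: each exponent is a lower bound
    there and is attained. *)
Lemma Psi_largest_monomial (w : 'S_n) : largest_monomial_divisor (Psi w) (eta_mnm w).
Proof.
split=> [|m' /mdvd_msupp H].
  apply/mdvd_msupp => mm hm; apply/mnm_lepP => i; rewrite mnmE.
  exact: Psi_exponent_ge.
apply/mdvd_msupp => mm; rewrite msuppX inE => /eqP ->.
apply/mnm_lepP => i; rewrite mnmE; have [k hk ek] := Psi_exponent_eq i w.
by have /mnm_lepP /(_ i) := H k hk; rewrite ek.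
Qed.

End Psi.

Unset Implicit Arguments.

Theorem mainTheorem3 (n : nat) (hn : (3 <= n)%N) :
  (exists psi : 'S_n -> FracT n, is_stationary psi /\ is_normalized psi) /\
  (forall psi : 'S_n -> FracT n,
     is_stationary psi -> is_normalized psi ->
     forall w : 'S_n,
       exists p : PolyT n, psi w = p%:F /\ largest_monomial_divisor p (eta_mnm w)).
Proof.
have st : is_stationary (fun w : 'S_n => (Psi w)%:F).
  move=> w; rewrite -rmorphM Psi_balance // rmorph_sum.
  by apply: eq_bigr => p _; rewrite rmorphM.
have norm : is_normalized (fun w : 'S_n => (Psi w)%:F) by rewrite /is_normalized Psi_id.
split; first by exists (fun w => (Psi w)%:F).
move=> psi st' norm' w; exists (Psi w); split; last exact: Psi_largest_monomial.
by apply: (stationary_unique hn st' st); rewrite norm'.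
Qed.
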